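(* Let $f:\subseteq\mathbb{R}^n\to\mathbb{R}^m$ be computable, open, and semi-algebraic over $\mathbb{R}_c$, with open domain $X:=\operatorname{dom}(f)$. Then $X$ is r.e. open and $f$ is effectively open.
   Context: $\mathbb{R}_c$ denotes the field of computable real numbers. For a subfield $F\subseteq\mathbb{R}$, a set $S\subseteq\mathbb{R}^n$ is basic semi-algebraic over $F$ if $S=\{\vec x:p_1(\vec x)\ge0,\dots,p_k(\vec x)\ge0,q_1(\vec x)>0,\dots,q_\ell(\vec x)>0\}$ for some polynomials $p_i,q_j\in F[X_1,\dots,X_n]$; semi-algebraic over $F$ if a finite union of intersections of such sets; a partial function $f:\subseteq\mathbb{R}^n\to\mathbb{R}^m$ is semi-algebraic over $F$ if its graph $\{(\vec x,f(\vec x)):\vec x\in\operatorname{dom}f\}\subseteq\mathbb{R}^{n+m}$ is. Computability in the Type-2 sense (Weihrauch), with Cauchy representation for $\mathbb{R}^n$ and $\theta^d_<$ for open sets (a name lists rational centers and radii of open balls with union the set); r.e. open means having a computable $\theta^n_<$-name. $f$ open and effectively open means $U\mapsto f[U]$, for open $U\subseteq X$, is $(\theta^n_<\to\theta^m_<)$-computable. *)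

(* Defs.v *)
From Stdlib Require Import Reals.
From mathcomp Require Import all_boot all_algebra.
From mathcomp Require Import Rstruct.
From mathcomp Require Import mpoly.

Set Implicit Arguments.
Unset Strict Implicit.
Unset Printing Implicit Defensive.
Import GRing.Theory Num.Theory.
Local Open Scope ring_scope.

(* 1. Model of computation: Kleene's partial recursive functions relative   *)
(*    to an oracle alpha : nat -> nat (mu-recursive codes, big-step         *)
(*    semantics).  Type-2 computability on Baire space N^N is defined by    *)
(*    uniform oracle computability: F :<= N^N -> N^N is computable iff a    *)
(*    single code e computes k |-> F(p)(k) from oracle p, for all p in dom F.*)

Definition baire := nat -> nat.

Inductive code : Type :=
  | CZero : code
  | CSucc : code
  | CProj : nat -> code
  | COracle : code
  | CComp : code -> list code -> code
  | CPrimRec : code -> code -> code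
  | CMu : code -> code.

Inductive eval (alpha : baire) : code -> seq nat -> nat -> Prop :=
  | ev_zero xs : eval alpha CZero xs 0
  | ev_succ xs : eval alpha CSucc xs (nth 0 xs 0).+1
  | ev_proj i xs : eval alpha (CProj i) xs (nth 0 xs i)
  | ev_oracle xs : eval alpha COracle xs (alpha (nth 0 xs 0))
  | ev_comp f gs xs ys y :
      evals alpha gs xs ys -> eval alpha f ys y -> eval alpha (CComp f gs) xs y
  | ev_prec0 f g xs y :
      eval alpha f xs y -> eval alpha (CPrimRec f g) (0 :: xs) y
  | ev_precS f g n xs r y :
      eval alpha (CPrimRec f g) (n :: xs) r ->
      eval alpha g (n :: r :: xs) y ->
      eval alpha (CPrimRec f g) (n.+1 :: xs) y
  | ev_mu f xs y :
      eval alpha f (y :: xs) 0 ->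
      (forall z, (z < y)%N -> exists v, eval alpha f (z :: xs) v.+1) ->
      eval alpha (CMu f) xs y
with evals (alpha : baire) : list code -> seq nat -> seq nat -> Prop :=
  | evs_nil xs : evals alpha nil xs [::]
  | evs_cons g gs xs y ys :
      eval alpha g xs y -> evals alpha gs xs ys ->
      evals alpha (g :: gs) xs (y :: ys).

Definition computes (e : code) (p q : baire) : Prop :=
  forall k, eval p e [:: k] (q k).

Definition computable_baire (q : baire) : Prop :=
  exists e, computes e (fun _ => 0%N) q.

Definition realizes {X Y : Type} (delta1 : baire -> X -> Prop)
  (delta2 : baire -> Y -> Prop) (dom : X -> Prop) (F : X -> Y) (e : code) :=
  forall x, dom x -> forall p, delta1 p x ->
    exists q, delta2 q (F x) /\ computes e p q.

Definition computable_wrt {X Y : Type} (delta1 : baire -> X -> Prop)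
  (delta2 : baire -> Y -> Prop) (dom : X -> Prop) (F : X -> Y) : Prop :=
  exists e, realizes delta1 delta2 dom F e.

Definition ratv (n : nat) (q : 'rV[rat]_n) : 'rV[R]_n := map_mx (@ratr R) q.

Definition edist (n : nat) (x y : 'rV[R]_n) : R :=
  Num.sqrt (\sum_(i < n) (x 0 i - y 0 i) ^+ 2).

Definition eopen (n : nat) (U : 'rV[R]_n -> Prop) : Prop :=
  forall x, U x -> exists2 eps : R, 0 < eps &
    forall y, edist x y < eps -> U y.

Definition cauchy_name (n : nat) (p : baire) (x : 'rV[R]_n) : Prop :=
  exists q : nat -> 'rV[rat]_n,
    (forall k, unpickle (p k) = Some (q k)) /\
    (forall i j, (i < j)%N -> edist (ratv (q i)) (ratv (q j)) <= 2 ^- i) /\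
    (forall i, edist (ratv (q i)) x <= 2 ^- i).

(* open ball with rational center and rational radius (empty if r <= 0) *)
Definition rball (n : nat) (c : 'rV[rat]_n * rat) (y : 'rV[R]_n) : Prop :=
  edist (ratv c.1) y < ratr c.2.

Definition open_name (n : nat) (p : baire) (U : 'rV[R]_n -> Prop) : Prop :=
  exists c : nat -> 'rV[rat]_n * rat,
    (forall k, unpickle (p k) = Some (c k)) /\
    (forall y, U y <-> exists k, rball (c k) y).

Definition re_open (n : nat) (U : 'rV[R]_n -> Prop) : Prop :=
  exists p, computable_baire p /\ open_name p U.

Definition Rc (a : R) : Prop :=
  exists p, computable_baire p /\ cauchy_name p (const_mx a : 'rV[R]_1).

Definition poly_over (F : R -> Prop) (n : nat) (P : {mpoly R[n]}) : Prop :=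
  forall m, F (P@_m).

Definition peval (n : nat) (P : {mpoly R[n]}) (x : 'rV[R]_n) : R :=
  P.@[fun i => x 0 i].

Definition basic_sa_set (n : nat) (ps qs : seq {mpoly R[n]}) (x : 'rV[R]_n) : Prop :=
  (forall P, P \in ps -> 0 <= peval P x) /\ (forall Q, Q \in qs -> 0 < peval Q x).

Definition basic_data_over (F : R -> Prop) (n : nat)
  (d : seq {mpoly R[n]} * seq {mpoly R[n]}) : Prop :=
  (forall P, P \in d.1 -> poly_over F P) /\ (forall Q, Q \in d.2 -> poly_over F Q).

Definition semialgebraic (F : R -> Prop) (n : nat) (S : 'rV[R]_n -> Prop) : Prop :=
  exists B : seq (seq (seq {mpoly R[n]} * seq {mpoly R[n]})),
    (forall l, l \in B -> forall d, d \in l -> basic_data_over F d) /\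
    (forall x, S x <-> exists2 l, l \in B & forall d, d \in l -> basic_sa_set d.1 d.2 x).

(* A partial function f :<= R^n -> R^m is given by its domain [dom] and a
   total function [f] whose values outside [dom] are irrelevant. *)
Definition graph (n m : nat) (dom : 'rV[R]_n -> Prop) (f : 'rV[R]_n -> 'rV[R]_m)
  (z : 'rV[R]_(n + m)) : Prop :=
  exists2 x, dom x & z = row_mx x (f x).

Definition semialgebraic_fun (F : R -> Prop) (n m : nat) (dom : 'rV[R]_n -> Prop)
  (f : 'rV[R]_n -> 'rV[R]_m) : Prop := semialgebraic F (graph dom f).

Definition image_of (n m : nat) (f : 'rV[R]_n -> 'rV[R]_m) (U : 'rV[R]_n -> Prop)
  (y : 'rV[R]_m) : Prop := exists2 x, U x & y = f x.

Definition open_map (n m : nat) (dom : 'rV[R]_n -> Prop) (f : 'rV[R]_n -> 'rV[R]_m) :=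
  forall U, eopen U -> (forall x, U x -> dom x) -> eopen (image_of f U).

Definition computable_fun (n m : nat) (dom : 'rV[R]_n -> Prop) (f : 'rV[R]_n -> 'rV[R]_m) :=
  computable_wrt (@cauchy_name n) (@cauchy_name m) dom f.

Definition effectively_open (n m : nat) (dom : 'rV[R]_n -> Prop) (f : 'rV[R]_n -> 'rV[R]_m) :=
  computable_wrt (@open_name n) (@open_name m)
    (fun U => eopen U /\ forall x, U x -> dom x) (image_of f).

(* Main.v *)
(* An open set is the union of the rational balls it contains, so everything
   reduces to deciding, for rational balls B and B', whether B' is contained in
   f[B] (or in X).  By quantifier elimination this is a Boolean combination of
   polynomial (in)equalities in the centers and radii, with coefficients in the
   field generated by the computable coefficients describing the graph.  Fix a
   basis, over the rationals, of the span of these coefficients: a polynomial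
   takes the value sum_i b_i * g_i at a rational point, with g_i rational and
   b_i linearly independent, so it vanishes iff all g_i do, and otherwise its
   sign is found by approximating the b_i.  The test is thus decidable (with the
   basis as finite advice), and f[U] is the union of the B' contained in some
   f[B], where B runs through the balls listed by the given name of U. *)
Require Import Defs.
From Stdlib Require Import Reals.
From mathcomp Require Import all_boot all_order all_algebra.
From mathcomp Require Import Rstruct.
From mathcomp Require Import reals mpoly ring lra zify.
From mathcomp Require qe_rcf_th qe_rcf.
Set Implicit Arguments.
Unset Strict Implicit.
Unset Printing Implicit Defensive.
Import Order.TTheory GRing.Theory Num.Theory.
Local Open Scope ring_scope.
Module QE := qe_rcf.

(** Signs can be decided only because the arguments are rational: at real arguments the factors
    [g_i] would be real numbers themselves, with no test for their vanishing. So no quantifier over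
    real points may survive, and it must be known which constants the elimination introduces.
    Correctness of quantifier elimination concerns truth values and says nothing about this; hence
    each transformer of the procedure is followed through and shown to add rational constants only.
    The constants need not form a field: they stay inside terms, and evaluating a term only leads to
    products of them, whose approximations multiply. The basis is extracted by classical logic,
    separately for each of the finitely many polynomials of the final formula. One listed ball at a
    time suffices in the image test, since [f[U]] is the union of the images of these balls;
    openness of [f] puts every point of such an image into a rational ball inside it. *)

Lemma has_exists (T X : Type) (a : X -> pred T) (b : pred T) (d : seq T) :
  (forall c, reflect (exists x, a x c) (b c)) ->
  (exists x, has (a x) d) <-> has b d.
Proof.
move=> h; elim: d => [|c d IH] /=; first by split=> // -[].
split=> [[x /orP[hx|hx]]|/orP[/h[x hx]|/IH[x hx]]].
- by apply/orP; left; apply/h; exists x.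
- by apply/orP; right; apply/IH; exists x.
- by exists x; rewrite hx.
- by exists x; rewrite hx orbT.
Qed.

(** * Constants in quantifier elimination *)

Section Constants.
Variables (F : rcfType) (K : F -> Prop).
Hypothesis K_rat : forall q : rat, K (ratr q).

(* [qe_rcf] writes quantifier elimination as formula transformers in
   continuation-passing style; the [form_over_*] lemmas follow each of them and
   show that it only introduces rational constants. *)
Fixpoint term_over (t : QE.term F) : Prop := match t with
  | QE.Const c => K c
  | QE.Add u v | QE.Mul u v => term_over u /\ term_over v
  | QE.Opp u | QE.NatMul u _ | QE.Exp u _ => term_over u
  | _ => True
  end.

Fixpoint form_over (f : QE.formula F) : Prop := match f with
  | QE.Bool _ => True
  | QE.Equal t u | QE.Lt t u | QE.Le t u => term_over t /\ term_over u
  | QE.And f g | QE.Or f g | QE.Implies f g => form_over f /\ form_over g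
  | QE.Not f => form_over f
  end.

Fixpoint terms_over (p : QE.polyF F) : Prop :=
  if p is t :: q then term_over t /\ terms_over q else True.
Fixpoint polys_over (ps : seq (QE.polyF F)) : Prop :=
  if ps is p :: qs then terms_over p /\ polys_over qs else True.

Lemma K0 : K 0. Proof. by rewrite -(rmorph0 (@ratr F)); exact: K_rat. Qed.
Lemma Kint (n : int) : K n%:~R. Proof. by rewrite -ratr_int; exact: K_rat. Qed.

Lemma terms_over_cons t p : term_over t -> terms_over p -> terms_over (t :: p).
Proof. by split. Qed.
Lemma terms_over_head t p : terms_over (t :: p) -> term_over t.
Proof. by case. Qed.
Lemma terms_over_behead t p : terms_over (t :: p) -> terms_over p.
Proof. by case. Qed.

Lemma form_over_If f g h : form_over f -> form_over g -> form_over h -> form_over (QE.If f g h).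
Proof. by []. Qed.

Lemma form_over_Size p k : terms_over p -> (forall n, form_over (k n)) -> form_over (QE.Size p k).
Proof.
elim: p k => [|c p IH] k hp hk; first exact: hk.
apply: IH => [|[|n]]; [exact: terms_over_behead hp| |exact: hk].
by move: (terms_over_head hp) (hk 0%N) (hk 1%N).
Qed.

Lemma form_over_Isnull p k : terms_over p -> (forall b, form_over (k b)) ->
  form_over (QE.Isnull p k).
Proof. by move=> hp hk; apply: form_over_Size. Qed.

Lemma form_over_LeadCoef p k :
  terms_over p -> (forall t, term_over t -> form_over (k t)) -> form_over (QE.LeadCoef p k).
Proof.
elim: p k => [|c p IH] k hp hk; first exact/hk/K0.
apply: IH => [|t ht]; first exact: terms_over_behead hp.
by apply: form_over_If => //; apply: hk => //; apply: terms_over_head hp.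
Qed.

Lemma terms_over_AmulXn a n : term_over a -> terms_over (QE.AmulXn a n).
Proof.
move=> ha; elim: n => [|n IH]; first by apply: terms_over_cons.
by apply: terms_over_cons => //; exact: K0.
Qed.

Lemma terms_over_AddPoly p q : terms_over p -> terms_over q -> terms_over (QE.AddPoly p q).
Proof.
elim: p q => [|a p IH] [|b q] //= [ha hp] [hb hq].
by split; [split | apply: IH].
Qed.

Lemma terms_over_ScalPoly c p : term_over c -> terms_over p -> terms_over (QE.ScalPoly c p).
Proof.
move=> hc; by elim: p => [|a p IH] //= [ha hp]; split; [split | apply: IH].
Qed.

Lemma terms_over_MulPoly p q : terms_over p -> terms_over q -> terms_over (QE.MulPoly p q).
Proof.
elim: p => [|a p IH] // [ha hp] hq.
apply: terms_over_AddPoly; first exact: terms_over_ScalPoly.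
by apply: terms_over_cons => //; apply: IH.
Qed.

Lemma pok1 : terms_over [:: QE.NatConst F 1]. Proof. exact: terms_over_cons. Qed.

Lemma terms_over_ExpPoly p n : terms_over p -> terms_over (QE.ExpPoly p n).
Proof.
move=> hp; case: n => [|n]; first exact: pok1.
rewrite /QE.ExpPoly iteropS; elim: n => //= n IH.
exact: terms_over_MulPoly.
Qed.

Lemma terms_over_OppPoly p : terms_over p -> terms_over (QE.OppPoly p).
Proof. by apply: terms_over_ScalPoly; have := Kint (-1); rewrite mulrN1z. Qed.

Lemma terms_over_NatMulPoly n p : terms_over p -> terms_over (QE.NatMulPoly n p).
Proof. exact: terms_over_ScalPoly. Qed.

Lemma terms_over_Deriv p : terms_over p -> terms_over (QE.Deriv p).
Proof.
elim: p => // a p IH [ha hp].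
by apply: terms_over_AddPoly => //; apply: terms_over_cons => //; apply: IH.
Qed.

Lemma form_over_Rediv_rec_loop q sq cq c qq r n k :
  terms_over q -> term_over cq -> terms_over qq -> terms_over r ->
  (forall c qq r, terms_over qq -> terms_over r -> form_over (k (c, qq, r))) ->
  form_over (QE.Rediv_rec_loop q sq cq c qq r n k).
Proof.
move=> hq hcq hqq hr hk.
(* The quotient and remainder of one pseudo-division step. Multiplying by the leading coefficient
   [cq] replaces division, so no inverse of a constant appears. *)
have hstep lr i q1 r1 : term_over lr -> terms_over q1 -> terms_over r1 ->
    terms_over (QE.AddPoly (QE.MulPoly q1 [:: cq]) (QE.AmulXn lr i)) /\
    terms_over (QE.AddPoly (QE.MulPoly r1 [:: cq]) (QE.OppPoly (QE.MulPoly (QE.AmulXn lr i) q))).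
  move=> hlr hq1 hr1; have hm : terms_over (QE.AmulXn lr i) by apply: terms_over_AmulXn.
  have hc : terms_over [:: cq] by apply: terms_over_cons.
  split; apply: terms_over_AddPoly => //; first exact: terms_over_MulPoly.
    exact: terms_over_MulPoly.
  by apply: terms_over_OppPoly; apply: terms_over_MulPoly.
elim: n c qq r hqq hr => [|n IH] c qq r hqq hr;
  apply: form_over_Size => // sr; case: ifP => _; do ?[exact: hk];
  apply: form_over_LeadCoef => // lr hlr; have [h1 h2] := hstep _ (sr - sq)%N _ _ hlr hqq hr.
  exact: hk.
exact: IH.
Qed.

Lemma form_over_Rediv p q k : terms_over p -> terms_over q ->
  (forall c qq r, terms_over qq -> terms_over r -> form_over (k (c, qq, r))) ->
    form_over (QE.Rediv p q k).
Proof.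
move=> hp hq hk; apply: form_over_Isnull => // -[].
  by apply: hk => //; apply: terms_over_cons => //; exact: K0.
apply: form_over_Size => // sq; apply: form_over_Size => // sp;
  apply: form_over_LeadCoef => // lq hlq.
by apply: form_over_Rediv_rec_loop => //; apply: terms_over_cons => //; exact: K0.
Qed.

Lemma form_over_Rmod p q k : terms_over p -> terms_over q -> (forall r, terms_over r ->
  form_over (k r)) ->
  form_over (QE.Rmod p q k).
Proof. by move=> hp hq hk; apply: form_over_Rediv => // *; exact: hk. Qed.

Lemma form_over_Rscal p q k : terms_over p -> terms_over q -> (forall n, form_over (k n)) ->
  form_over (QE.Rscal p q k).
Proof. by move=> hp hq hk; apply: form_over_Rediv => // *; exact: hk. Qed.

Lemma form_over_Rgcd_loop n p q k : terms_over p -> terms_over q -> (forall r, terms_over r ->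
  form_over (k r)) ->
  form_over (QE.Rgcd_loop n p q k).
Proof.
elim: n p q => [|n IH] p q hp hq hk; apply: form_over_Rmod => // r hr;
  apply: form_over_Isnull => // -[]; do ?[exact: hk].
exact: IH.
Qed.

Lemma form_over_Rgcd p q k : terms_over p -> terms_over q -> (forall r, terms_over r ->
  form_over (k r)) ->
  form_over (QE.Rgcd p q k).
Proof.
move=> hp hq hk; rewrite /QE.Rgcd /QE.LtSize.
apply: form_over_Size => // n; apply: form_over_Size => // m; case: (_ < _)%N;
  apply: form_over_Isnull => // -[]; do ?[exact: hk];
  by apply: form_over_Size => // s; apply: form_over_Rgcd_loop.
Qed.

Lemma polys_over_cons p ps : terms_over p -> polys_over ps -> polys_over (p :: ps).
Proof. by split. Qed.
Lemma polys_over_head p ps : polys_over (p :: ps) -> terms_over p.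
Proof. by case. Qed.
Lemma polys_over_behead p ps : polys_over (p :: ps) -> polys_over ps.
Proof. by case. Qed.

Lemma form_over_BigRgcd ps k : polys_over ps -> (forall r, terms_over r -> form_over (k r)) ->
  form_over (QE.BigRgcd ps k).
Proof.
elim: ps k => [|p ps IH] k hps hk; first by apply: hk; apply: terms_over_cons => //; exact: K0.
apply: IH => [|r hr]; first exact: polys_over_behead hps.
by apply: form_over_Rgcd => //; exact: polys_over_head hps.
Qed.

Lemma form_over_Changes s k : terms_over s -> (forall n, form_over (k n)) ->
  form_over (QE.Changes s k).
Proof.
elim: s k => [|a s IH] k hs hk; first exact: hk.
apply: IH => [|v]; first exact: terms_over_behead hs.
apply: form_over_If => //=; do 2!split => //; first exact: terms_over_head hs.
by case: s hs => //= b s [_ []].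
Qed.

Lemma form_over_SeqPInfty ps k : polys_over ps -> (forall s, terms_over s -> form_over (k s)) ->
  form_over (QE.SeqPInfty ps k).
Proof.
elim: ps k => [|p ps IH] k hps hk; first exact: hk.
apply: form_over_LeadCoef => [|t ht]; first exact: polys_over_head hps.
apply: IH => [|s hs]; first exact: polys_over_behead hps.
by apply: hk; apply: terms_over_cons.
Qed.

Lemma form_over_SeqMInfty ps k : polys_over ps -> (forall s, terms_over s -> form_over (k s)) ->
  form_over (QE.SeqMInfty ps k).
Proof.
elim: ps k => [|p ps IH] k hps hk; first exact: hk.
have hp := polys_over_head hps.
apply: form_over_LeadCoef => // t ht; apply: form_over_Size => // n.
apply: IH => [|s hs]; first exact: polys_over_behead hps.
apply: hk; apply: terms_over_cons => //; split => //=.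
by have := Kint (-1); rewrite mulrN1z.
Qed.

Lemma form_over_ChangesPoly ps k : polys_over ps -> (forall n, form_over (k n)) ->
  form_over (QE.ChangesPoly ps k).
Proof.
move=> hps hk; apply: form_over_SeqMInfty => // s hs; apply: form_over_SeqPInfty => // s' hs'.
by apply: form_over_Changes => // n; apply: form_over_Changes => // m; exact: hk.
Qed.

Lemma form_over_NextMod p q k : terms_over p -> terms_over q -> (forall r, terms_over r ->
  form_over (k r)) ->
  form_over (QE.NextMod p q k).
Proof.
move=> hp hq hk; apply: form_over_LeadCoef => // t ht; apply: form_over_Rscal => // n.
by apply: form_over_Rmod => // r hr; apply: hk; apply: terms_over_ScalPoly.
Qed.

Lemma form_over_ModsAux p q n k : terms_over p -> terms_over q -> (forall s, polys_over s ->
  form_over (k s)) ->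
  form_over (QE.ModsAux p q n k).
Proof.
elim: n p q k => [|n IH] p q k hp hq hk; first exact: hk.
apply: form_over_Isnull => // -[]; first exact: hk.
apply: form_over_NextMod => // r hr; apply: IH => // s hs.
by apply: hk; apply: polys_over_cons.
Qed.

Lemma form_over_Mods p q k : terms_over p -> terms_over q -> (forall s, polys_over s ->
  form_over (k s)) ->
  form_over (QE.Mods p q k).
Proof.
by move=> hp hq hk; apply: form_over_Size => // n; apply: form_over_Size => // m;
  apply: form_over_ModsAux.
Qed.

Lemma polys_over_nth ps i : polys_over ps -> terms_over (nth [::] ps i).
Proof.
elim: ps i => [|p ps IH] [|i] //= h; first exact: polys_over_head h.
exact: IH (polys_over_behead h).
Qed.

Lemma terms_over_reduce (I : Type) (s : seq I) (G : I -> QE.polyF F) :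
  (forall i, terms_over (G i)) ->
  terms_over (reducebig [:: QE.NatConst F 1] s (fun i => BigBody i (@QE.MulPoly F) true (G i))).
Proof.
move=> h; elim: s => [|i s IH]; first exact: pok1.
exact: terms_over_MulPoly.
Qed.

Lemma terms_over_PolyComb sq sc : polys_over sq -> terms_over (QE.PolyComb sq sc).
Proof.
by move=> h; apply: terms_over_reduce => i; apply: terms_over_ExpPoly; apply: polys_over_nth.
Qed.

Lemma terms_over_Pcq sq i : polys_over sq -> terms_over (QE.Pcq sq i).
Proof.
rewrite /QE.Pcq => h; apply: polys_over_nth.
by elim: (qe_rcf_th.sg_tab _) => [|c s IH] //=; apply: polys_over_cons => //;
  apply: terms_over_PolyComb.
Qed.

Lemma form_over_TaqsR p sq i k : terms_over p -> polys_over sq -> (forall t, term_over t ->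
  form_over (k t)) ->
  form_over (QE.TaqsR p sq i k).
Proof.
move=> hp hsq hk; apply: form_over_Mods => // [|s hs].
  by apply: terms_over_MulPoly; [apply: terms_over_Deriv|apply: terms_over_Pcq].
by apply: form_over_ChangesPoly => // n; apply: hk; apply: Kint.
Qed.

Lemma terms_over_BoundingPoly sq : polys_over sq -> terms_over (QE.BoundingPoly sq).
Proof.
move=> h; apply: terms_over_Deriv; elim: sq h => [|p sq IH] h; first exact: pok1.
by case: h => hp hs; apply: terms_over_MulPoly; last exact: IH.
Qed.

(** Sign determination inverts a matrix with integer entries, so its coefficients are rational. The
    witness is the same coefficient computed over [rat], as field morphisms commute with matrix
    inversion. *)
Lemma coefs_ratr n i : exists q : rat, qe_rcf_th.coefs F n i = ratr q.
Proof.
exists (qe_rcf_th.coefs rat n i).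
rewrite /qe_rcf_th.coefs.
have [lt_i|le_i] := ltnP i (size (enum 'I_(3 ^ n))); last first.
  by rewrite !nth_default ?(esym (rmorph0 (@ratr F))) // (leq_trans _ le_i) // size_map.
have x0 : 'I_(3 ^ n) by rewrite size_enum_ord in lt_i; exact: Ordinal lt_i.
rewrite [LHS](nth_map x0); last exact: lt_i.
rewrite [in RHS](nth_map x0); last exact: lt_i.
rewrite !castmxE -[X in _ = X]/(_ _); set M := qe_rcf_th.ctmat n.
have -> : map_mx (intr : int -> F) M = map_mx (@ratr F) (map_mx (intr : int -> rat) M).
  by apply/matrixP => u v; rewrite !mxE ratr_int.
by rewrite -map_invmx mxE.
Qed.

Lemma term_over_Coefs n i : term_over (QE.Coefs F n i).
Proof.
(* [QE.Coefs] is a constant, so its value in any environment, here the empty one, is that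
   constant. *)
change (K (QE.eval [::] (QE.Coefs F n i))).
by rewrite QE.eval_Coefs; have [q ->] := coefs_ratr n i.
Qed.

Lemma form_over_CcountWeak p sq k : terms_over p -> polys_over sq -> (forall t, term_over t ->
  form_over (k t)) ->
  form_over (QE.CcountWeak p sq k).
Proof.
move=> hp hsq hk; rewrite /QE.CcountWeak.
have : term_over (QE.NatConst F 0) by [].
move: (QE.NatConst F 0); elim: (3 ^ _)%N => [|n IH] t ht; first exact: hk.
by apply: form_over_TaqsR => // x hx; apply: IH; do 2!split => //; apply: term_over_Coefs.
Qed.

Lemma form_over_reduce sq (G : QE.polyF F -> QE.formula F) : polys_over sq ->
  (forall p, terms_over p -> form_over (G p)) ->
  form_over (reducebig (QE.Bool true) sq (fun q => BigBody q (@QE.And F) true (G q))).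
Proof.
move=> hsq hG; elim: sq hsq => [|p sq IH] h //=.
by split; [apply: hG; apply: polys_over_head h | apply: IH; apply: polys_over_behead h].
Qed.

Lemma form_over_CcountGt0 sp sq : polys_over sp -> polys_over sq -> form_over (QE.CcountGt0 sp sq).
Proof.
move=> hsp hsq; apply: form_over_BigRgcd => // p hp; apply: form_over_Isnull => // -[] /=.
  (* When all equations vanish identically, the solution set is open. If nonempty, it contains a
     critical point of the product of the inequalities, or it reaches infinity, where leading
     coefficients and degree parities give the signs. *)
  apply: form_over_CcountWeak => // [|t ht]; first exact: terms_over_BoundingPoly.
  split; last split => //.
    by apply: form_over_reduce => // q hq; apply: form_over_LeadCoef.
  apply: form_over_reduce => // q hq; apply: form_over_Size => // n.
  by apply: form_over_LeadCoef.
by apply: form_over_CcountWeak.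
Qed.

Lemma terms_over_abstrX i t : term_over t -> terms_over (QE.abstrX i t).
Proof.
elim: t => [n|c|n|t IHt u IHu|t IHt|t IHt n|t IHt u IHu|t IHt n] /=.
- by move=> _; case: ifP => _; do ?[apply: terms_over_cons => //].
- by move=> h; split.
- by move=> h; split.
- by case=> /IHt ht /IHu hu; apply: terms_over_AddPoly.
- by move=> /IHt ht; apply: terms_over_OppPoly.
- by move=> /IHt ht; apply: terms_over_NatMulPoly.
- by case=> /IHt ht /IHu hu; apply: terms_over_MulPoly.
- by move=> /IHt ht; apply: terms_over_ExpPoly.
Qed.

Lemma polys_over_abstrX i s : terms_over s -> polys_over (map (QE.abstrX i) s).
Proof. by elim: s => //= t s IH [ht hs]; split; [apply: terms_over_abstrX | apply: IH]. Qed.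

(** * Disjunctive normal forms and elimination of one variable *)

Definition clause := (seq (QE.term F) * seq (QE.term F))%type.

(** Equations and strict inequalities only: this is the input that the root counting of
    [QE.CcountGt0] accepts. *)
Definition clause_holds (e : seq F) (c : clause) :=
  all (fun t => QE.eval e t == 0) c.1 && all (fun t => 0 < QE.eval e t) c.2.

Fixpoint dnf_over (d : seq clause) : Prop :=
  if d is c :: d' then terms_over c.1 /\ terms_over c.2 /\ dnf_over d' else True.

Definition clause_and (d1 d2 : seq clause) : seq clause :=
  [seq (c1.1 ++ c2.1, c1.2 ++ c2.2) | c1 <- d1, c2 <- d2].

Lemma clause_andE e d1 d2 : has (clause_holds e) (clause_and d1 d2)
  = has (clause_holds e) d1 && has (clause_holds e) d2.
Proof.
elim: d1 => //= c d1 IH; rewrite has_cat IH has_map andb_orl; congr (_ || _).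
elim: d2 {IH} => [|c2 d2 IH] /=; first by rewrite andbF.
rewrite IH andb_orr /clause_holds /= !all_cat; congr (_ || _).
by rewrite -!andbA; congr (_ && _); rewrite andbCA.
Qed.

Lemma terms_over_cat s1 s2 : terms_over s1 -> terms_over s2 -> terms_over (s1 ++ s2).
Proof. by elim: s1 => //= t s1 IH [ht h1] h2; split; last exact: IH. Qed.

Lemma dnf_over_cat d1 d2 : dnf_over d1 -> dnf_over d2 -> dnf_over (d1 ++ d2).
Proof. by elim: d1 => //= c d1 IH [h1 [h2 h]] hd; do 2!split => //; apply: IH. Qed.

Lemma dnf_over_and d1 d2 : dnf_over d1 -> dnf_over d2 -> dnf_over (clause_and d1 d2).
Proof.
elim: d1 => //= c d1 IH [h1 [h2 h]] hd2; apply: dnf_over_cat; last exact: IH.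
by elim: d2 hd2 {IH} => //= c2 d2 IH [? [? ?]]; do ?[split]; do ?[apply: terms_over_cat]; auto.
Qed.

(** Normal forms of [f] and of its negation are built together: [Not] then swaps them and [Implies]
    uses both, while trichotomy splits the negated atoms. *)
Lemma dnf_exists f : form_over f -> exists d d', [/\ dnf_over d, dnf_over d' &
  forall e, QE.qf_eval e f = has (clause_holds e) d /\
            ~~ QE.qf_eval e f = has (clause_holds e) d'].
Proof.
have sub t u : term_over t -> term_over u -> term_over (QE.Add t (QE.Opp u)) by split.
elim: f => [b|t u|t u|t u|f IHf g IHg|f IHf g IHg|f IHf g IHg|f IHf] /=.
- move=> _; exists (if b then [:: ([::], [::])] else [::]).
  exists (if b then [::] else [:: ([::], [::])]).
  by case: b; split.
- case=> ht hu; exists [:: ([:: QE.Add t (QE.Opp u)], [::])].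
  exists [:: ([::], [:: QE.Add t (QE.Opp u)]); ([::], [:: QE.Add u (QE.Opp t)])].
  split=> // e; rewrite /clause_holds /= subr_eq0 !subr_gt0 !andbT !orbF; split => //.
  by rewrite neq_lt orbC.
- case=> ht hu; exists [:: ([::], [:: QE.Add u (QE.Opp t)])].
  exists [:: ([::], [:: QE.Add t (QE.Opp u)]); ([:: QE.Add t (QE.Opp u)], [::])].
  split=> // e; rewrite /clause_holds /= subr_eq0 !subr_gt0 !andbT !orbF; split => //.
  by rewrite -leNgt le_eqVlt orbC eq_sym.
- case=> ht hu.
  exists [:: ([::], [:: QE.Add u (QE.Opp t)]); ([:: QE.Add t (QE.Opp u)], [::])].
  exists [:: ([::], [:: QE.Add t (QE.Opp u)])].
  split=> // e; rewrite /clause_holds /= subr_eq0 !subr_gt0 !andbT !orbF; split => //.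
    by rewrite le_eqVlt orbC.
  by rewrite -ltNge.
- case=> /IHf[d1 [d1' [h1 h1' H1]]] /IHg[d2 [d2' [h2 h2' H2]]].
  exists (clause_and d1 d2), (d1' ++ d2'); split; [exact: dnf_over_and|exact: dnf_over_cat|].
  move=> e; have [a1 b1] := H1 e; have [a2 b2] := H2 e.
  by rewrite clause_andE has_cat negb_and -a1 -b1 -a2 -b2.
- case=> /IHf[d1 [d1' [h1 h1' H1]]] /IHg[d2 [d2' [h2 h2' H2]]].
  exists (d1 ++ d2), (clause_and d1' d2'); split; [exact: dnf_over_cat|exact: dnf_over_and|].
  move=> e; have [a1 b1] := H1 e; have [a2 b2] := H2 e.
  by rewrite clause_andE has_cat negb_or -a1 -b1 -a2 -b2.
- case=> /IHf[d1 [d1' [h1 h1' H1]]] /IHg[d2 [d2' [h2 h2' H2]]].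
  exists (d1' ++ d2), (clause_and d1 d2'); split; [exact: dnf_over_cat|exact: dnf_over_and|].
  move=> e; have [a1 b1] := H1 e; have [a2 b2] := H2 e.
  by rewrite clause_andE has_cat negb_imply -a1 -b1 -a2 -b2 implybE.
- move=> /IHf[d1 [d1' [h1 h1' H1]]]; exists d1', d1; split => // e.
  by have [a1 b1] := H1 e; rewrite negbK.
Qed.

Definition clause_proj i (c : clause) : QE.formula F :=
  QE.CcountGt0 (map (QE.abstrX i) c.1) (map (QE.abstrX i) c.2).

Lemma clause_projP i c e : reflect (exists x, clause_holds (set_nth 0 e i x) c)
  (QE.qf_eval e (clause_proj i c)).
Proof.
rewrite /clause_proj QE.eval_CcountGt0.
apply: (equivP (qe_rcf_th.ccount_gt0P _ _)).
suff h x : (\big[andb/true]_(p <- map (QE.eval_poly e) (map (QE.abstrX i) c.1)) (p.[x] == 0)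
   && \big[andb/true]_(q <- map (QE.eval_poly e) (map (QE.abstrX i) c.2)) (q.[x] > 0))
   = clause_holds (set_nth 0 e i x) c.
  by split=> -[x hx]; exists x; rewrite ?h // in hx *; rewrite -h.
rewrite !big_all !all_map /clause_holds; congr (_ && _);
  by apply: eq_all => t /=; rewrite QE.abstrXP.
Qed.

(** * Sets definable with constants in [K] *)

Definition definable (S : seq F -> Prop) :=
  exists f, form_over f /\ forall e, S e <-> QE.qf_eval e f.

Definition pdef (g : seq F -> F) := exists t, term_over t /\ forall e, g e = QE.eval e t.

Lemma definable_ext S S' : (forall e, S e <-> S' e) -> definable S -> definable S'.
Proof. by move=> h [f [hf H]]; exists f; split=> // e; rewrite -h. Qed.

Lemma definable_stable S e : definable S -> ~ ~ S e -> S e.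
Proof. by move=> [f [_ ->]] h; apply/negPn/negP => hx; apply: h => h; rewrite h in hx. Qed.

Lemma definable_and S S' : definable S -> definable S' ->
  definable (fun e => S e /\ S' e).
Proof.
move=> [f [hf H]] [g [hg G]]; exists (QE.And f g); split=> // e.
by rewrite H G /=; split=> /andP.
Qed.

Lemma definable_or S S' : definable S -> definable S' ->
  definable (fun e => S e \/ S' e).
Proof.
move=> [f [hf H]] [g [hg G]]; exists (QE.Or f g); split=> // e.
by rewrite H G /=; split=> /orP.
Qed.

Lemma definable_not S : definable S -> definable (fun e => ~ S e).
Proof. by move=> [f [hf H]]; exists (QE.Not f); split=> // e; rewrite H /=; split=> /negP. Qed.

Lemma definable_bool (b : bool) : definable (fun _ => b).
Proof. by exists (QE.Bool b). Qed.

(** The quantifier commutes with the disjunction of the normal form, so each clause is projected on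
    its own. *)
Lemma definable_ex i S : definable S ->
  definable (fun e => exists x, S (set_nth 0 e i x)).
Proof.
move=> [f [hf H]]; have [d [d' [hd _ Hd]]] := dnf_exists hf.
exists (foldr (@QE.Or F) (QE.Bool false) (map (clause_proj i) d)); split.
  elim: d hd {Hd} => //= c d IH [h1 [h2 h3]]; split; last exact: IH.
  by apply: form_over_CcountGt0; apply: polys_over_abstrX.
move=> e.
have -> : QE.qf_eval e (foldr (@QE.Or F) (QE.Bool false) (map (clause_proj i) d))
  = has (fun c => QE.qf_eval e (clause_proj i c)) d.
  by elim: d {Hd hd} => //= c d ->.
rewrite -(has_exists d (fun c => clause_projP i c e)).
by split=> -[x hx]; exists x; move: hx; rewrite H (Hd _).1.
Qed.

Lemma pdef_const c : K c -> pdef (fun _ => c).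
Proof. by move=> hc; exists (QE.Const c). Qed.

Lemma pdef_var i : pdef (fun e => e`_i).
Proof. by exists (QE.Var F i). Qed.

Lemma pdef_add g h : pdef g -> pdef h -> pdef (fun e => g e + h e).
Proof. by move=> [t [ht H]] [u [hu G]]; exists (QE.Add t u); split=> //= e; rewrite H G. Qed.

Lemma pdef_opp g : pdef g -> pdef (fun e => - g e).
Proof. by move=> [t [ht H]]; exists (QE.Opp t); split=> //= e; rewrite H. Qed.

Lemma pdef_mul g h : pdef g -> pdef h -> pdef (fun e => g e * h e).
Proof. by move=> [t [ht H]] [u [hu G]]; exists (QE.Mul t u); split=> //= e; rewrite H G. Qed.

Lemma pdef_exp g k : pdef g -> pdef (fun e => g e ^+ k).
Proof. by move=> [t [ht H]]; exists (QE.Exp t k); split=> //= e; rewrite H. Qed.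

Lemma pdef_sum (I : Type) (s : seq I) (P : pred I) (g : I -> seq F -> F) :
  (forall i, pdef (g i)) -> pdef (fun e => \sum_(i <- s | P i) g i e).
Proof.
move=> hg; elim: s => [|i s IH].
  by exists (QE.NatConst F 0); split=> // e; rewrite big_nil.
case hP : (P i); last first.
  by have [t [ht H]] := IH; exists t; split=> // e; rewrite big_cons hP H.
by have [t [ht H]] := pdef_add (hg i) IH; exists t; split=> // e; rewrite big_cons hP H.
Qed.

Lemma pdef_prod (I : Type) (s : seq I) (P : pred I) (g : I -> seq F -> F) :
  (forall i, pdef (g i)) -> pdef (fun e => \prod_(i <- s | P i) g i e).
Proof.
move=> hg; elim: s => [|i s IH].
  by exists (QE.NatConst F 1); split=> // e; rewrite big_nil.
case hP : (P i); last first.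
  by have [t [ht H]] := IH; exists t; split=> // e; rewrite big_cons hP H.
by have [t [ht H]] := pdef_mul (hg i) IH; exists t; split=> // e; rewrite big_cons hP H.
Qed.

Lemma definable_lt g h : pdef g -> pdef h -> definable (fun e => g e < h e).
Proof. by move=> [t [ht H]] [u [hu G]]; exists (QE.Lt t u); split=> //= e; rewrite H G. Qed.

Lemma definable_le g h : pdef g -> pdef h -> definable (fun e => g e <= h e).
Proof. by move=> [t [ht H]] [u [hu G]]; exists (QE.Le t u); split=> //= e; rewrite H G. Qed.

Lemma definable_all_in (T : eqType) (s : seq T) (S : T -> seq F -> Prop) :
  (forall i, i \in s -> definable (S i)) ->
  definable (fun e => forall i, i \in s -> S i e).
Proof.
elim: s => [|a s IH] h.
  by apply: definable_ext (definable_bool true) => e; split.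
apply: definable_ext (definable_and (h a (mem_head _ _)) (IH _)) => [e|i hi].
  split=> [[ha hs] i|H]; first by rewrite inE => /orP[/eqP->|/hs].
  by split=> [|i hi]; apply: H; rewrite inE ?eqxx ?hi ?orbT.
by apply: h; rewrite inE hi orbT.
Qed.

Lemma definable_ex_in (T : eqType) (s : seq T) (S : T -> seq F -> Prop) :
  (forall i, i \in s -> definable (S i)) ->
  definable (fun e => exists2 i, i \in s & S i e).
Proof.
elim: s => [|a s IH] h.
  by apply: definable_ext (definable_bool false) => e; split=> // -[].
apply: definable_ext (definable_or (h a (mem_head _ _)) (IH _)) => [e|i hi].
  split=> [[ha|[i hi hS]]|[i]]; first by exists a; rewrite ?mem_head.
    by exists i; rewrite // inE hi orbT.
  by rewrite inE => /orP[/eqP->|hi hS]; [left|right; exists i].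
by apply: h; rewrite inE hi orbT.
Qed.

(** * Quantification over blocks of variables *)

(** Iterated [set_nth] rather than list surgery, so that a quantifier over the block unfolds into
    eliminations of single variables. *)
Fixpoint updv (e : seq F) k n (v : nat -> F) : seq F :=
  if n is n'.+1 then set_nth 0 (updv e k n' v) (k + n') (v n') else e.

Lemma nth_updv e k n v j :
  (updv e k n v)`_j = if (k <= j < k + n)%N then v (j - k)%N else e`_j.
Proof.
elim: n => [|n IH] /=; first by rewrite addn0; case: leqP => //= h; rewrite ltnNge h.
rewrite nth_set_nth /= IH addnS ltnS; case: eqP => [->|hj].
  by rewrite leq_addr leqnn addKn.
by rewrite [(j <= _)%N]leq_eqVlt (introF eqP hj).
Qed.

Lemma eq_updv e k n v w : (forall j, (j < n)%N -> v j = w j) ->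
  updv e k n v = updv e k n w.
Proof.
elim: n => //= n IH h; rewrite h // IH // => j hj.
by apply: h; apply: ltnW.
Qed.

Lemma definable_exv k n S : definable S ->
  definable (fun e => exists v, S (updv e k n v)).
Proof.
elim: n S => [|n IH] S hS.
  by apply: definable_ext hS => e; split=> [h|[v]//]; exists (fun=> 0).
apply: definable_ext (IH _ (definable_ex (k + n) hS)) => e; split=> [[v [x h]]|[v h]].
  pose w j := if j == n then x else v j; exists w => /=.
  suff -> : updv e k n w = updv e k n v by rewrite /w eqxx.
  by apply: eq_updv => j hj; rewrite /w ltn_eqF.
by exists v, (v n).
Qed.

End Constants.

Local Open Scope nat_scope.

(** * Functions computed by oracle codes *)

(** One code has to serve all oracles: this is the uniformity in Type-2 computability. Its behavior
    matters on lists of length [N] only. *)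
Definition cfun (N : nat) (F : baire -> seq nat -> nat) :=
  exists e, forall al xs, size xs = N -> eval al e xs (F al xs).

Lemma cfun_ext N F G : (forall al xs, size xs = N -> F al xs = G al xs) ->
  cfun N F -> cfun N G.
Proof. by move=> h [e he]; exists e => al xs hxs; rewrite -h //; exact: he. Qed.

Lemma cfun_proj N i : cfun N (fun _ xs => nth 0 xs i).
Proof. by exists (CProj i) => al xs _; constructor. Qed.

Lemma cfun_comp M N G Fs : cfun M G -> size Fs = M ->
  (forall i, cfun N (nth (fun _ _ => 0) Fs i)) ->
  cfun N (fun al xs => G al [seq F al xs | F <- Fs]).
Proof.
move=> [g hg] hM hF.
suff [es hes] : exists es, forall al xs, size xs = N ->
    evals al es xs [seq F al xs | F <- Fs].
  exists (CComp g es) => al xs hxs; apply: ev_comp (hes _ _ hxs) _.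
  by apply: hg; rewrite size_map.
elim: Fs {M G g hg hM} hF => [|F Fs IH] hF; first by exists nil => *; constructor.
have [e he] := hF 0; have [es hes] := IH (fun i => hF i.+1).
by exists (e :: es) => al xs hxs /=; constructor; [apply: he | apply: hes].
Qed.

Lemma cfun_comp1 G N F : cfun 1 (fun al xs => G al (nth 0 xs 0)) -> cfun N F ->
  cfun N (fun al xs => G al (F al xs)).
Proof.
move=> hG hF; apply: (cfun_comp (Fs := [:: F]) hG) => // -[//|i] /=.
by rewrite nth_nil; exists CZero => *; constructor.
Qed.

Lemma cfun_comp2 G N F1 F2 :
  cfun 2 (fun al xs => G al (nth 0 xs 0) (nth 0 xs 1)) -> cfun N F1 -> cfun N F2 ->
  cfun N (fun al xs => G al (F1 al xs) (F2 al xs)).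
Proof.
move=> hG h1 h2; apply: (cfun_comp (Fs := [:: F1; F2]) hG) => // -[//|[//|i]] /=.
by rewrite nth_nil; exists CZero => *; constructor.
Qed.

Lemma cfun_const N c : cfun N (fun _ _ => c).
Proof.
elim: c => [|c IH]; first by exists CZero => *; constructor.
apply: (cfun_comp1 (G := fun _ x => x.+1)) IH.
by exists CSucc => *; constructor.
Qed.

Lemma cfun_succ N F : cfun N F -> cfun N (fun al xs => (F al xs).+1).
Proof.
apply: (cfun_comp1 (G := fun _ x => x.+1)).
by exists CSucc => *; constructor.
Qed.

Lemma cfun_oracle N F : cfun N F -> cfun N (fun al xs => al (F al xs)).
Proof.
apply: (cfun_comp1 (G := fun al x => al x)).
by exists COracle => *; constructor.
Qed.

Lemma map_nth_iota (xs : seq nat) : [seq nth 0 xs i | i <- iota 0 (size xs)] = xs.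
Proof. exact: mkseq_nth. Qed.

Lemma cfun_extend N F H : cfun N.+1 F -> cfun N H ->
  cfun N (fun al xs => F al (H al xs :: xs)).
Proof.
move=> hF hH.
pose Fs := H :: [seq (fun (_ : baire) xs => nth 0 xs i) | i <- iota 0 N].
apply: cfun_ext (cfun_comp (Fs := Fs) hF _ _).
- by move=> al xs hxs; rewrite /= -map_comp -hxs; congr (F al (_ :: _)); apply: map_nth_iota.
- by rewrite /= size_map size_iota.
- case=> [//|i] /=; have [hi|hi] := ltnP i N.
    by rewrite (nth_map 0) ?size_iota // nth_iota //; exact: cfun_proj.
  by rewrite nth_default ?size_map ?size_iota //; exact: cfun_const.
Qed.

Fixpoint primrec (b : nat) (s : nat -> nat -> nat) n : nat :=
  if n is m.+1 then s m (primrec b s m) else b.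

Lemma cfun_rec N B S H : cfun N B -> cfun N.+2 S -> cfun N H ->
  cfun N (fun al xs => primrec (B al xs) (fun n r => S al [:: n, r & xs]) (H al xs)).
Proof.
move=> [b hb] [s hs].
apply: (cfun_extend (F := fun al xs =>
   primrec (B al (behead xs)) (fun n r => S al [:: n, r & behead xs]) (head 0 xs))).
exists (CPrimRec b s) => al [|n xs] //= [hxs].
elim: n => [|n IH] /=; first by constructor; apply: hb.
by apply: ev_precS IH _; apply: hs; rewrite /= hxs.
Qed.

(* Unbounded search is only used for values that do not depend on which
   solution of [F = 0] is found, so that no minimization function is needed. *)
Lemma cfun_search N F T V : cfun N.+1 F -> cfun N.+1 T ->
  (forall al xs, size xs = N -> exists k, F al (k :: xs) = 0) ->
  (forall al xs k, size xs = N -> F al (k :: xs) = 0 -> T al (k :: xs) = V al xs) ->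
  cfun N V.
Proof.
move=> [f hf] [t ht] hex hV.
exists (CComp t (CMu f :: [seq CProj i | i <- iota 0 N])) => al xs hxs.
have hex' : exists k, F al (k :: xs) == 0 by have [k hk] := hex al xs hxs; exists k; apply/eqP.
case: (ex_minnP hex') => k /eqP hk hmin.
apply: (@ev_comp _ _ _ _ (k :: xs)); last by rewrite -(hV _ _ k) //; apply: ht; rewrite /= hxs.
constructor.
  constructor; first by rewrite -hk; apply: hf; rewrite /= hxs.
  move=> z hz; exists (F al (z :: xs)).-1.
  rewrite prednK; first by apply: hf; rewrite /= hxs.
  by rewrite lt0n; apply: contraTneq hz => h; rewrite -leqNgt; apply: hmin; apply/eqP.
rewrite -{2}(map_nth_iota xs) hxs.
by elim: (iota 0 N) => [|i s IH] /=; do ?[constructor].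
Qed.

Lemma cfun_add N F G : cfun N F -> cfun N G -> cfun N (fun al xs => F al xs + G al xs).
Proof.
apply: (cfun_comp2 (G := fun _ x y => x + y)).
apply: cfun_ext (cfun_rec (cfun_proj 2 1) (cfun_succ (cfun_proj _ 1)) (cfun_proj _ 0)).
by move=> al xs _; elim: (nth 0 xs 0) => //= n ->.
Qed.

Lemma cfun_mul N F G : cfun N F -> cfun N G -> cfun N (fun al xs => F al xs * G al xs).
Proof.
apply: (cfun_comp2 (G := fun _ x y => x * y)).
apply: cfun_ext (cfun_rec (cfun_const 2 0)
  (cfun_add (cfun_proj _ 1) (cfun_proj _ 3)) (cfun_proj _ 0)).
by move=> al xs _; elim: (nth 0 xs 0) => //= n ->; rewrite mulSn addnC.
Qed.

Lemma cfun_pred N F : cfun N F -> cfun N (fun al xs => (F al xs).-1).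
Proof.
apply: (cfun_comp1 (G := fun _ x => x.-1)).
apply: cfun_ext (cfun_rec (cfun_const 1 0) (cfun_proj _ 0) (cfun_proj _ 0)).
by move=> al xs _; case: (nth 0 xs 0).
Qed.

Lemma cfun_sub N F G : cfun N F -> cfun N G -> cfun N (fun al xs => F al xs - G al xs).
Proof.
apply: (cfun_comp2 (G := fun _ x y => x - y)).
apply: cfun_ext (cfun_rec (cfun_proj 2 0) (cfun_pred (cfun_proj _ 1)) (cfun_proj _ 1)).
by move=> al xs _; elim: (nth 0 xs 1) => /= [|n ->]; rewrite ?subn0 // subnS.
Qed.

Lemma cfun_exp N F G : cfun N F -> cfun N G -> cfun N (fun al xs => F al xs ^ G al xs).
Proof.
apply: (cfun_comp2 (G := fun _ x y => x ^ y)).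
apply: cfun_ext (cfun_rec (cfun_const 2 1)
  (cfun_mul (cfun_proj _ 2) (cfun_proj _ 1)) (cfun_proj _ 1)).
by move=> al xs _; elim: (nth 0 xs 1) => //= n ->; rewrite expnS.
Qed.

(** The step of a primitive recursion sees the counter, the accumulator and the parameters; a
    summand does not depend on the accumulator, whose slot is cut out. *)
Lemma cfun_skip N F : cfun N.+1 F ->
  cfun N.+2 (fun al xs => F al (nth 0 xs 0 :: drop 2 xs)).
Proof.
move=> hF; pose Fs := [seq (fun (_ : baire) xs => nth 0 xs i) | i <- 0 :: iota 2 N].
apply: cfun_ext (cfun_comp (Fs := Fs) hF _ _).
- move=> al [|x [|y xs]] //= [<-]; rewrite drop0 -map_comp; congr (F al (_ :: _)).
  by rewrite (iotaDl 2 0) -map_comp /=; apply: map_nth_iota.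
- by rewrite /= size_map size_iota.
- move=> i; have [hi|hi] := ltnP i N.+1.
    by rewrite (nth_map 0) /= ?size_iota //; exact: cfun_proj.
  by rewrite nth_default ?size_map /= ?size_iota //; exact: cfun_const.
Qed.

(** Sums of booleans replace bounded search: quotients, coprimality and valuations are obtained
    below by counting. *)
Lemma cfun_sum N F H : cfun N.+1 F -> cfun N H ->
  cfun N (fun al xs => \sum_(i < H al xs) F al ((i : nat) :: xs)).
Proof.
move=> hF hH.
apply: cfun_ext (cfun_rec (cfun_const N 0)
  (cfun_add (cfun_proj _ 1) (cfun_skip hF)) hH) => al xs hxs.
elim: (H al xs) => [|n IH] /=; first by rewrite big_ord0.
by rewrite big_ord_recr /= IH drop0.
Qed.

(** * Decidable predicates and number-theoretic functions *)

Definition cpred N (P : baire -> seq nat -> bool) := cfun N (fun al xs => P al xs).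

Lemma cpred_ext N P P' : (forall al xs, size xs = N -> P al xs = P' al xs) ->
  cpred N P -> cpred N P'.
Proof. by move=> h; apply: cfun_ext => al xs hxs; rewrite h. Qed.

Lemma cpred_const N b : cpred N (fun _ _ => b). Proof. exact: cfun_const. Qed.

Lemma cpred_not N P : cpred N P -> cpred N (fun al xs => ~~ P al xs).
Proof.
move=> h; apply: cfun_ext (cfun_sub (cfun_const N 1) h) => al xs _.
by case: (P al xs).
Qed.

Lemma cpred_and N P P' : cpred N P -> cpred N P' ->
  cpred N (fun al xs => P al xs && P' al xs).
Proof.
by move=> h h'; apply: cfun_ext (cfun_mul h h') => al xs _; rewrite mulnb.
Qed.

Lemma cpred_or N P P' : cpred N P -> cpred N P' ->
  cpred N (fun al xs => P al xs || P' al xs).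
Proof.
move=> h h'; apply: cpred_ext (cpred_not (cpred_and (cpred_not h) (cpred_not h'))).
by move=> al xs _; rewrite negb_and !negbK.
Qed.

Lemma cpred_leq N F G : cfun N F -> cfun N G -> cpred N (fun al xs => F al xs <= G al xs).
Proof.
move=> hF hG; apply: cfun_ext (cfun_sub (cfun_const N 1) (cfun_sub hF hG)) => al xs _.
by rewrite -subn_eq0; case: (F al xs - G al xs).
Qed.

Lemma cpred_eq N F G : cfun N F -> cfun N G -> cpred N (fun al xs => F al xs == G al xs).
Proof.
move=> hF hG; apply: cpred_ext (cpred_and (cpred_leq hF hG) (cpred_leq hG hF)).
by move=> al xs _; rewrite eqn_leq.
Qed.

Lemma cfun_if N P F G : cpred N P -> cfun N F -> cfun N G ->
  cfun N (fun al xs => if P al xs then F al xs else G al xs).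
Proof.
move=> hP hF hG.
apply: cfun_ext (cfun_add (cfun_mul hP hF) (cfun_mul (cpred_not hP) hG)) => al xs _.
by case: (P al xs); rewrite /= ?mul1n ?mul0n ?addn0.
Qed.

Lemma sum_ltn q x : \sum_(i < x) (i < q) = minn x q.
Proof.
elim: x => [|x IH]; first by rewrite big_ord0 min0n.
by rewrite big_ord_recr /= IH; case: (ltnP x q) => h; rewrite ?addn0 ?addn1; lia.
Qed.

(** The quotient of [x] by [y] counts the [i < x] with [(i + 1) y <= x]; the guard [0 < y] yields
    the conventional quotient 0 when [y = 0]. *)
Lemma cfun_div N F G : cfun N F -> cfun N G -> cfun N (fun al xs => F al xs %/ G al xs).
Proof.
apply: (cfun_comp2 (G := fun _ x y => x %/ y)).
have hlt : cpred 3 (fun _ xs => 0 < nth 0 xs 2).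
  exact: (cpred_leq (cfun_const 3 1) (cfun_proj 3 2)).
have hle : cpred 3 (fun _ xs => (nth 0 xs 0).+1 * nth 0 xs 2 <= nth 0 xs 1).
  by apply: cpred_leq; [apply: cfun_mul; [apply: cfun_succ|]|]; exact: cfun_proj.
apply: cfun_ext (cfun_sum (cpred_and hlt hle) (cfun_proj 2 0)) => al [|x [|y []]] //= _.
case: y => [|y]; first by rewrite divn0 big1.
under eq_bigr => i _ do rewrite -leq_divRL //.
by rewrite sum_ltn; apply/minn_idPr/leq_div.
Qed.

Lemma cpred_dvd N F G : cfun N F -> cfun N G -> cpred N (fun al xs => F al xs %| G al xs).
Proof.
move=> hF hG; apply: cpred_ext (cpred_eq (cfun_mul (cfun_div hG hF) hF) hG).
by move=> al xs _; rewrite dvdn_eq.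
Qed.

Lemma cpred_coprime N F G : cfun N F -> cfun N G ->
  cpred N (fun al xs => coprime (F al xs) (G al xs)).
Proof.
move=> hF hG.
have h : cfun 2 (fun _ xs => coprime (nth 0 xs 0) (nth 0 xs 1));
  last exact: (cfun_comp2 (G := fun _ x y => coprime x y) h hF hG).
pose D := fun (_ : baire) xs => [&& 1 < nth 0 xs 0,
  nth 0 xs 0 %| nth 0 xs 1 & nth 0 xs 0 %| nth 0 xs 2].
have hD : cpred 3 D.
  apply: cpred_and; first exact: (cpred_leq (cfun_const 3 2) (cfun_proj 3 0)).
  by apply: cpred_and; apply: cpred_dvd; exact: cfun_proj.
(* The bound on common divisors has to exceed the gcd, which is at most [x + y], and to leave room
   for the divisor 2 when [x = y = 0], where the gcd is 0. *)
have hB : cfun 2 (fun _ xs => (nth 0 xs 0 + nth 0 xs 1).+3).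
  by do 3!apply: cfun_succ; apply: cfun_add; exact: cfun_proj.
apply: cpred_ext (cpred_eq (cfun_sum hD hB) (cfun_const 2 0)) => al [|x [|y []]] //= _.
rewrite sum_nat_eq0; apply/forallP/idP => [h|h [i hi]]; last first.
  rewrite implyTb /D /= eqb0; apply/negP => /and3P[h1 h2 h3].
  have : i %| gcdn x y by rewrite dvdn_gcd h2.
  by rewrite (eqP h) dvdn1 => /eqP ?; subst i.
have hdvd d : 1 < d < (x + y).+3 -> d %| x -> ~~ (d %| y).
  case/andP=> h1 hd hdx; have := h (Ordinal hd).
  by rewrite implyTb /D /= eqb0 h1 hdx.
have [g0|g0] := posnP (gcdn x y).
  have [/eqP x0 /eqP y0] : x == 0 /\ y == 0.
    by move: (gcdn_gt0 x y); rewrite g0 ltnn => /esym/norP; rewrite -!eqn0Ngt.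
  have : ~~ (2 %| y) by apply: hdvd; rewrite x0.
  by rewrite y0.
apply/negPn/negP; rewrite /coprime => g1.
have hle : gcdn x y <= x + y.
  have [x0|x0] := posnP x; first by rewrite x0 gcd0n.
  by rewrite (leq_trans (dvdn_leq x0 (dvdn_gcdl _ _))) // leq_addr.
suff : ~~ (gcdn x y %| y) by rewrite dvdn_gcdr.
by apply: hdvd; [lia | apply: dvdn_gcdl].
Qed.

(** * Rational- and real-valued functions *)

Local Open Scope ring_scope.

(** Fractions are not kept in lowest terms, and the sign is carried by a difference of naturals:
    arithmetic then needs neither a gcd nor a case distinction. The successor keeps the denominator
    nonzero. *)
Definition crat (N : nat) (G : baire -> seq nat -> rat) :=
  exists A B D, [/\ cfun N A, cfun N B, cfun N D &
    forall al xs, size xs = N ->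
      G al xs = ((A al xs)%:R - (B al xs)%:R) / (D al xs).+1%:R].

Lemma crat_ext N F G : (forall al xs, size xs = N -> F al xs = G al xs) ->
  crat N F -> crat N G.
Proof.
move=> h [A [B [D [hA hB hD H]]]]; exists A, B, D; split=> // al xs hxs.
by rewrite -h // H.
Qed.

Lemma crat_nat N F : cfun N F -> crat N (fun al xs => (F al xs)%:R).
Proof.
move=> hF; exists F, (fun _ _ => 0%N), (fun _ _ => 0%N).
by split=> // *; [exact: cfun_const|exact: cfun_const|rewrite subr0 divr1].
Qed.

Lemma crat_opp N F : crat N F -> crat N (fun al xs => - F al xs).
Proof.
move=> [A [B [D [hA hB hD H]]]]; exists B, A, D; split=> // al xs hxs.
by rewrite H // -mulNr opprB.
Qed.

Lemma crat_add N F G : crat N F -> crat N G -> crat N (fun al xs => F al xs + G al xs).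
Proof.
move=> [A [B [D [hA hB hD H]]]] [A' [B' [D' [hA' hB' hD' H']]]].
exists (fun al xs => A al xs * (D' al xs).+1 + A' al xs * (D al xs).+1)%N.
exists (fun al xs => B al xs * (D' al xs).+1 + B' al xs * (D al xs).+1)%N.
(* The predecessor of the product of the denominators [D + 1] and [D' + 1]. *)
exists (fun al xs => D al xs * D' al xs + (D al xs + D' al xs))%N.
split; do ?[apply: cfun_add|apply: cfun_mul|apply: cfun_succ|done].
move=> al xs hxs; rewrite H // H' //; move: (A _ _) (A' _ _) (B _ _) (B' _ _) (D _ _) (D' _ _).
move=> a a' b b' d d'.
have -> : (d * d' + (d + d')).+1 = (d.+1 * d'.+1)%N by lia.
have : d.+1%:R != 0 :> rat by rewrite pnatr_eq0.
have : d'.+1%:R != 0 :> rat by rewrite pnatr_eq0.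
rewrite !natrD !natrM; move: (d.+1%:R) (d'.+1%:R) => x y hy hx.
by field; rewrite hx hy.
Qed.

Lemma crat_mul N F G : crat N F -> crat N G -> crat N (fun al xs => F al xs * G al xs).
Proof.
move=> [A [B [D [hA hB hD H]]]] [A' [B' [D' [hA' hB' hD' H']]]].
exists (fun al xs => A al xs * A' al xs + B al xs * B' al xs)%N.
exists (fun al xs => A al xs * B' al xs + B al xs * A' al xs)%N.
exists (fun al xs => D al xs * D' al xs + (D al xs + D' al xs))%N.
split; do ?[apply: cfun_add|apply: cfun_mul|apply: cfun_succ|done].
move=> al xs hxs; rewrite H // H' //; move: (A _ _) (A' _ _) (B _ _) (B' _ _) (D _ _) (D' _ _).
move=> a a' b b' d d'.
have -> : (d * d' + (d + d')).+1 = (d.+1 * d'.+1)%N by lia.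
have : d.+1%:R != 0 :> rat by rewrite pnatr_eq0.
have : d'.+1%:R != 0 :> rat by rewrite pnatr_eq0.
rewrite !natrD !natrM; move: (d.+1%:R) (d'.+1%:R) => x y hy hx.
by field; rewrite hx hy.
Qed.

Lemma crat_const N q : crat N (fun _ _ => q).
Proof.
exists (fun _ _ => if 0 <= numq q then `|numq q|%N else 0%N).
exists (fun _ _ => if 0 <= numq q then 0%N else `|numq q|%N).
exists (fun _ _ => (`|denq q|%N).-1); split; do ?[exact: cfun_const].
move=> _ _ _; rewrite prednK ?absz_gt0 ?denq_neq0 //.
rewrite -[LHS]divq_num_den -(gez0_abs (denq_ge0 q)) /=; congr (_ / _).
case: ifP => [h|/negbT]; first by rewrite subr0 -{1}(gez0_abs h).
rewrite -ltNge => h; rewrite sub0r -{1}[numq q]opprK -abszN.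
by rewrite -{1}(@gez0_abs (- numq q)) ?oppr_ge0 ?ltW // mulrNz.
Qed.

Lemma crat_comp N u F : crat 1 (fun _ xs => u (nth 0%N xs 0)) -> cfun N F ->
  crat N (fun al xs => u (F al xs)).
Proof.
move=> [A [B [D [hA hB hD H]]]] hF.
have aux E : cfun 1 E -> cfun N (fun al xs => E al [:: F al xs]).
  by move=> hE; apply: (cfun_comp1 (G := fun al x => E al [:: x])) hF;
    apply: cfun_ext hE => al [|x []].
exists (fun al xs => A al [:: F al xs]), (fun al xs => B al [:: F al xs]),
  (fun al xs => D al [:: F al xs]); split; do ?[exact: aux].
by move=> al xs hxs; rewrite -(H al [:: F al xs]).
Qed.

(** The dropped entry is the search index that [cfun_search] puts in front of the arguments. *)
Lemma crat_skip N F : crat N F -> crat N.+1 (fun al xs => F al (behead xs)).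
Proof.
move=> [A [B [D [hA hB hD H]]]].
have aux E : cfun N E -> cfun N.+1 (fun al xs => E al (behead xs)).
  move=> hE; pose Fs := [seq (fun (_ : baire) xs => nth 0%N xs i) | i <- iota 1 N].
  apply: cfun_ext (cfun_comp (Fs := Fs) hE _ _).
  - move=> al [|x xs] //= [hxs]; rewrite /Fs -hxs -map_comp; congr (E al _).
    by rewrite (iotaDl 1 0) -map_comp /=; apply: map_nth_iota.
  - by rewrite /= size_map size_iota.
  - move=> i; have [hi|hi] := ltnP i N.
      by rewrite (nth_map 0%N) ?size_iota //; exact: cfun_proj.
    by rewrite nth_default ?size_map ?size_iota //; exact: cfun_const.
exists (fun al xs => A al (behead xs)), (fun al xs => B al (behead xs)),
  (fun al xs => D al (behead xs)); split; do ?[exact: aux].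
by move=> al [|x xs] //= [hxs]; rewrite H.
Qed.

Lemma cpred_gt0 N F : crat N F -> cpred N (fun al xs => 0 < F al xs).
Proof.
move=> [A [B [D [hA hB hD H]]]].
apply: cpred_ext (cpred_leq (cfun_succ hB) hA) => al xs hxs.
by rewrite H // pmulr_lgt0 ?invr_gt0 ?ltr0n // subr_gt0 ltr_nat.
Qed.

Lemma cpred_eq0 N F : crat N F -> cpred N (fun al xs => F al xs == 0).
Proof.
move=> hF; apply: cpred_ext (cpred_not (cpred_or (cpred_gt0 hF) (cpred_gt0 (crat_opp hF)))).
by move=> al xs _; rewrite oppr_gt0 negb_or -!leNgt eq_le andbC.
Qed.

Lemma crat_sum (T : Type) N (s : seq T) (P : pred T) (G : T -> baire -> seq nat -> rat) :
  (forall i, crat N (G i)) -> crat N (fun al xs => \sum_(i <- s | P i) G i al xs).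
Proof.
move=> h; elim: s => [|a s IH].
  by apply: crat_ext (crat_const N 0) => al xs _; rewrite big_nil.
case hP : (P a); last by apply: crat_ext IH => al xs _; rewrite big_cons hP.
by apply: crat_ext (crat_add (h a) IH) => al xs _; rewrite big_cons hP.
Qed.

(** * Sign tests for rational combinations of approximable reals *)

Local Open Scope ring_scope.

(* The constant [M] makes the class closed under products without rescaling
   the index. *)
Definition approximable (a : R) := exists (u : nat -> rat) (M : nat),
  crat 1 (fun _ xs => u (nth 0%N xs 0)) /\
  forall k, `|ratr (u k) - a| <= M%:R / 2 ^+ k.

Lemma approximable_ratr q : approximable (ratr q).
Proof.
exists (fun _ => q), 0%N; split; first exact: crat_const.
by move=> k; rewrite subrr normr0 mul0r.
Qed.

Lemma approximable_mul a b : approximable a -> approximable b -> approximable (a * b).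
Proof.
move=> [u [M [hu hM]]] [v [L [hv hL]]].
(* From [x y - a b = x (y - b) + (x - a) b] and [|x| <= |a| + M], as the error [M / 2^k] is at most
   [M]. *)
pose C := (`|a| + M%:R) * L%:R + M%:R * `|b|.
have C0 : 0 <= C by rewrite addr_ge0 ?mulr_ge0 ?addr_ge0.
exists (fun k => u k * v k), (Num.bound C); split; first exact: crat_mul.
move=> k; apply: (@le_trans _ _ (C / 2 ^+ k)); last first.
  by rewrite ler_pM2r ?invr_gt0 ?exprn_gt0 // ltW // archi_boundP.
rewrite rmorphM; move: (hM k) (hL k) => /=.
suff key (x y : R) : `|x - a| <= M%:R / 2 ^+ k -> `|y - b| <= L%:R / 2 ^+ k ->
    `|x * y - a * b| <= C / 2 ^+ k by exact: key.
move=> hx hy.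
have -> : x * y - a * b = x * (y - b) + (x - a) * b by ring.
rewrite (le_trans (ler_normD _ _)) // !normrM /C mulrDl; apply: lerD.
  rewrite -[leRHS]mulrA; apply: ler_pM => //; rewrite -[x](subrK a) addrC.
  rewrite (le_trans (ler_normD _ _)) // lerD2l (le_trans hx) //.
  by rewrite ler_pdivrMr ?exprn_gt0 // ler_peMr // exprn_ege1 // ler1n.
by rewrite mulrAC; apply: ler_wpM2r.
Qed.

(** The reals [mu] are fixed advice; only the rational factors [g] depend on the input and are
    computed. *)
Definition lincomb N (G : baire -> seq nat -> R) :=
  exists (I : finType) (mu : I -> R) (g : I -> baire -> seq nat -> rat),
    [/\ forall i, approximable (mu i), forall i, crat N (g i) &
     forall al xs, size xs = N -> G al xs = \sum_i mu i * ratr (g i al xs)].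

Lemma lincomb_ext N F G : (forall al xs, size xs = N -> F al xs = G al xs) ->
  lincomb N F -> lincomb N G.
Proof.
move=> h [I [mu [g [h1 h2 H]]]]; exists I, mu, g; split=> // al xs hxs.
by rewrite -h // H.
Qed.

Lemma lincomb_const N a : approximable a -> lincomb N (fun _ _ => a).
Proof.
move=> ha; exists unit, (fun _ => a), (fun _ _ _ => 1).
by split=> // [_|al xs _]; [exact: crat_const | rewrite big_const card_unit /= rmorph1 mulr1 addr0].
Qed.

Lemma lincomb_rat N g : crat N g -> lincomb N (fun al xs => ratr (g al xs)).
Proof.
move=> hg; exists unit, (fun _ => 1), (fun _ => g).
split=> // [_|al xs _]; first by rewrite -(rmorph1 (@ratr R)); exact: approximable_ratr.
by rewrite big_const card_unit /= mul1r addr0.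
Qed.

Lemma lincomb_add N F G : lincomb N F -> lincomb N G -> lincomb N (fun al xs => F al xs + G al xs).
Proof.
move=> [I [mu [f [h1 h2 H]]]] [J [nu [g [k1 k2 K]]]].
exists (I + J)%type, (fun s => match s with inl i => mu i | inr j => nu j end).
exists (fun s => match s with inl i => f i | inr j => g j end).
split=> [[]//|[]//|al xs hxs].
by rewrite H // K // big_sumType.
Qed.

Lemma lincomb_mul N F G : lincomb N F -> lincomb N G -> lincomb N (fun al xs => F al xs * G al xs).
Proof.
move=> [I [mu [f [h1 h2 H]]]] [J [nu [g [k1 k2 K]]]].
exists (I * J)%type, (fun p => mu p.1 * nu p.2).
exists (fun p al xs => f p.1 al xs * g p.2 al xs).
split=> [[i j]|[i j]|al xs hxs]; [exact: approximable_mul|exact: crat_mul|].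
rewrite H // K // big_distrlr pair_big; apply: eq_bigr => -[i j] _ /=.
by rewrite rmorphM /=; ring.
Qed.

Lemma lincomb_opp N F : lincomb N F -> lincomb N (fun al xs => - F al xs).
Proof.
move=> hF; apply: lincomb_ext (lincomb_mul (lincomb_rat (crat_const N (-1))) hF) => al xs _.
by rewrite rmorphN1 mulN1r.
Qed.

Lemma lincomb_exp N F k : lincomb N F -> lincomb N (fun al xs => F al xs ^+ k).
Proof.
move=> hF; elim: k => [|k IH].
  by apply: lincomb_ext (lincomb_rat (crat_const N 1)) => al xs _; rewrite rmorph1.
by apply: lincomb_ext (lincomb_mul hF IH) => al xs _; rewrite exprS.
Qed.

(* Over Q-independent reals, a combination with rational coefficients vanishes
   iff all coefficients do: this makes exact equality tests possible. *)
Definition indep (I : finType) (A : {set I}) (mu : I -> R) :=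
  forall q : I -> rat, \sum_(i in A) mu i * ratr (q i) = 0 ->
  forall i, i \in A -> q i = 0.

Lemma lincomb_indep N (G : baire -> seq nat -> R) : lincomb N G ->
  exists (I : finType) (A : {set I}) (mu : I -> R) (g : I -> baire -> seq nat -> rat),
    [/\ forall i, approximable (mu i), forall i, crat N (g i), indep A mu &
     forall al xs, size xs = N -> G al xs = \sum_(i in A) mu i * ratr (g i al xs)].
Proof.
move=> [I [mu [g [h1 h2 H]]]]; exists I.
have {H} : exists g (A : {set I}), (forall i, crat N (g i)) /\
    (forall al xs, size xs = N -> G al xs = \sum_(i in A) mu i * ratr (g i al xs)).
  by exists g, setT; split=> // al xs hxs; rewrite H //; apply: eq_bigl => i; rewrite inE.
case=> {h2}g [A]; have [k] := ubnP #|A|.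
elim: k g A => // k IH g A hk [hg H].
(* Whether a relation exists is settled by excluded middle; its rational coefficients are then
   constants of the code. *)
have [hA|hA] := Classical_Prop.classic (indep A mu); first by exists A, mu, g.
have [q [hq [i0 [hi0 qi0]]]] : exists q : I -> rat,
    \sum_(i in A) mu i * ratr (q i) = 0 /\ exists i, i \in A /\ q i != 0.
  apply: Classical_Prop.NNPP => hn; apply: hA => q hq i hi.
  by apply/eqP/negPn/negP => hqi; apply: hn; exists q; split=> //; exists i.
(* Subtracting [g i0 / q i0] times the vanishing relation preserves the value and makes the
   coefficient at [i0] zero. *)
pose g' i al xs := g i al xs + (- (q i / q i0)) * g i0 al xs.
apply: (IH g' (A :\ i0)).
  by rewrite (cardsD1 i0) hi0 in hk.
split=> [i|al xs hxs]; first by apply: crat_add => //; apply: crat_mul => //; exact: crat_const.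
have -> : G al xs = \sum_(i in A) mu i * ratr (g' i al xs).
  rewrite H //; apply/eqP; rewrite -subr_eq0 -sumrB; apply/eqP.
  transitivity (\sum_(i in A) ratr (g i0 al xs / q i0) * (mu i * ratr (q i))).
    by apply: eq_bigr => i _; rewrite /g' rmorphD !rmorphM rmorphN !rmorphM /=; ring.
  by rewrite -big_distrr /= hq mulr0.
rewrite (big_setD1 i0 hi0) /= {1}/g' divff // mulN1r subrr rmorph0 mulr0 add0r.
by [].
Qed.

(** [|x| <= x * x + 1] trades the absolute value for a polynomial, so that the error bound is itself
    a rational computed from [x]. *)
Lemma approx_mul (u a m p x : R) : `|u - a| <= m / p -> `|u * x - a * x| <= m * (x * x + 1) / p.
Proof.
move=> h; rewrite -mulrBl normrM mulrAC; apply: (@le_trans _ _ (m / p * `|x|)).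
  by apply: ler_wpM2r.
apply: ler_wpM2l; first exact: le_trans h.
have -> : x * x = `|x| * `|x| by rewrite -normrM ger0_norm // -expr2 sqr_ge0.
have := sqr_ge0 (`|x| - 1); have := normr_ge0 x; nra.
Qed.

(** Termination of the sign search: once [|x| p] exceeds twice the error [w], the approximation [s]
    visibly differs from zero. *)
Lemma approx_separated (s w x p : R) : 0 < p -> `|s - x| * p <= w -> 2 * w < `|x| * p ->
  (w < s * p) || (w < - s * p).
Proof.
move=> hp h; have h1 : (x - s) * p <= `|s - x| * p.
  by rewrite ler_pM2r // distrC ler_norm.
have h2 : (s - x) * p <= `|s - x| * p by rewrite ler_pM2r // ler_norm.
rewrite mulrBl in h1; rewrite mulrBl in h2; rewrite mulNr.
by case: (ger0P x) => hx; rewrite ?mulNr => h3; apply/orP; [left|right]; lra.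
Qed.

(** Correctness of the sign search: an approximation larger than its error has the right sign. *)
Lemma approx_sign (s w x p : R) : 0 < p -> `|s - x| * p <= w ->
  (w < s * p) || (w < - s * p) -> (0 < s) = (0 < x).
Proof.
move=> hp h; have h0 : 0 <= `|s - x| * p by rewrite mulr_ge0 // ltW.
have h1 : (x - s) * p <= `|s - x| * p by rewrite ler_pM2r // distrC ler_norm.
have h2 : (s - x) * p <= `|s - x| * p by rewrite ler_pM2r // ler_norm.
rewrite mulrBl in h1; rewrite mulrBl in h2; rewrite mulNr -[LHS](pmulr_lgt0 _ hp).
rewrite -[RHS](pmulr_lgt0 _ hp) => /orP[h3|h3].
  have a1 : 0 < s * p by lra.
  have a2 : 0 < x * p by lra.
  by rewrite a1 a2.
have a1 : s * p <= 0 by lra.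
have a2 : x * p <= 0 by lra.
by rewrite !ltNge a1 a2.
Qed.

(** Independence turns the question whether [G] vanishes into a rational one, decided first; a
    nonzero [G] is separated from zero by a good enough approximation, so the search always ends. *)
Lemma pos_dec N G : lincomb N G -> cpred N (fun al xs => 0 < G al xs).
Proof.
move=> /lincomb_indep[I [A [mu [g [hmu hg hA H]]]]].
have [u hu] := fin_all_exists hmu.
have [M hM] := fin_all_exists hu.
have {hu hM} [hu hM] : (forall i, crat 1 (fun _ xs => u i (nth 0%N xs 0))) /\
   (forall i k, `|ratr (u i k) - mu i| <= (M i)%:R / 2 ^+ k).
  by split=> i; have [] := hM i.
pose S k al xs := \sum_(i in A) u i k * g i al xs.
(* [W / 2^k] bounds the error of the approximation [S k]. *)
pose W al xs := \sum_(i in A) (M i)%:R * (g i al xs * g i al xs + 1).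
(* A sum of squares vanishes iff all coefficients on [A] do. *)
pose Z al xs := \sum_(i in A) g i al xs * g i al xs == 0.
have hS : crat N.+1 (fun al xs => S (nth 0%N xs 0) al (behead xs)).
  apply: crat_sum => i; apply: crat_mul; last exact: crat_skip.
  by apply: crat_comp (hu i) _; exact: cfun_proj.
have hW : crat N W.
  apply: crat_sum => i; apply: crat_mul; first exact: crat_const.
  by apply: crat_add; [apply: crat_mul|exact: crat_const].
have hZ : crat N (fun al xs => \sum_(i in A) g i al xs * g i al xs).
  by apply: crat_sum => i; apply: crat_mul.
have hP : crat N.+1 (fun _ xs => (2 ^ nth 0 xs 0)%:R).
  by apply: crat_nat; apply: cfun_exp; [exact: cfun_const|exact: cfun_proj].
have hSP := crat_mul hS hP; have hW' := crat_opp (crat_skip hW).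
have hZ' := cpred_eq0 (crat_skip hZ).
have hstop := cpred_or hZ' (cpred_or (cpred_gt0 (crat_add hSP hW'))
   (cpred_gt0 (crat_add (crat_opp hSP) hW'))).
have hval := cpred_and (cpred_not hZ') (cpred_gt0 hS).
have hGZ al xs : size xs = N -> Z al xs -> G al xs = 0.
  move=> hxs; rewrite /Z psumr_eq0 => [/allP h|i _]; last by rewrite -expr2 sqr_ge0.
  rewrite H // big1 // => i hi.
  have /implyP/(_ hi) := h i (mem_index_enum _).
  by rewrite mulf_eq0 orbb => /eqP->; rewrite rmorph0 mulr0.
have hGN al xs : size xs = N -> ~~ Z al xs -> G al xs != 0.
  move=> hxs; apply: contraNneq; rewrite H // => h.
  by apply/eqP; rewrite big1 // => i hi; rewrite (hA _ h) ?mulr0.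
have err al xs k : size xs = N ->
    `|ratr (S k al xs) - G al xs| <= ratr (W al xs) / 2 ^+ k.
  move=> hxs; rewrite H // /S /W !rmorph_sum /= -sumrB (le_trans (ler_norm_sum _ _ _)) //.
  rewrite mulr_suml; apply: ler_sum => i _.
  have E1 : ratr ((M i)%:R * (g i al xs * g i al xs + 1)) =
      (M i)%:R * (ratr (g i al xs) * ratr (g i al xs) + 1) :> R.
    by rewrite rmorphM rmorphD rmorphM rmorph1 rmorph_nat.
  have E2 : ratr (u i k * g i al xs) = ratr (u i k) * ratr (g i al xs) :> R by exact: rmorphM.
  by rewrite E1 E2; apply: approx_mul.
have e2 k : 0 < 2 ^+ k :> R by rewrite exprn_gt0.
have hplus k al xs : (0 < S k al xs * (2 ^ k)%:R + - W al xs) =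
    (ratr (W al xs) < ratr (S k al xs) * 2 ^+ k :> R).
  by rewrite -(ltr0q R) rmorphD rmorphN rmorphM rmorph_nat natrX subr_gt0.
have hminus k al xs : (0 < - (S k al xs * (2 ^ k)%:R) + - W al xs) =
    (ratr (W al xs) < - ratr (S k al xs) * 2 ^+ k :> R).
  by rewrite -(ltr0q R) rmorphD !rmorphN rmorphM rmorph_nat natrX mulNr subr_gt0.
apply: (cfun_search (cpred_not hstop) hval) => [al xs hxs|al xs k hxs] /=.
  have [hz|hz] := boolP (Z al xs); first by exists 0%N; rewrite -/(Z al xs) hz.
  have G0 := hGN _ _ hxs hz.
  (* [2^k > k > 2 W / |G|] gives the separation [2 W < |G| 2^k]. *)
  pose k := Num.bound (2 * ratr (W al xs) / `|G al xs|); exists k.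
  apply/eqP; rewrite eqb0 negbK; apply/orP; right; rewrite hplus hminus.
  apply: (@approx_separated _ _ (G al xs)) => //; first by rewrite -ler_pdivlMr ?err.
  rewrite [ltRHS]mulrC -ltr_pdivrMr ?normr_gt0 //.
  apply: (@lt_trans _ _ k%:R); last by rewrite -natrX ltr_nat ltn_expl.
  apply: archi_boundP; rewrite divr_ge0 // mulr_ge0 // ler0q sumr_ge0 // => i _.
  by rewrite mulr_ge0 // addr_ge0 // -expr2 sqr_ge0.
move/eqP; rewrite eqb0 negbK hplus hminus -/(Z al xs) => hs.
have [hz|hz] := boolP (Z al xs); first by rewrite (hGZ _ _ hxs hz) ltxx.
move: hs; rewrite (negbTE hz) /= => hs; congr nat_of_bool; rewrite -(ltr0q R).
by apply: approx_sign hs => //; rewrite -ler_pdivlMr ?err.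
Qed.

Lemma eq0_dec N G : lincomb N G -> cpred N (fun al xs => G al xs == 0).
Proof.
move=> hG; apply: cpred_ext (cpred_not (cpred_or (pos_dec hG) (pos_dec (lincomb_opp hG)))).
by move=> al xs _; rewrite oppr_gt0 negb_or -!leNgt eq_le andbC.
Qed.

Lemma lincomb_term N (V : seq (baire -> seq nat -> rat)) (t : QE.term R) :
  (forall i, crat N (nth (fun _ _ => 0) V i)) -> term_over approximable t ->
  lincomb N (fun al xs => QE.eval [seq ratr (v al xs) | v <- V] t).
Proof.
move=> hV; elim: t => [i|c|n|t IHt u IHu|t IHt|t IHt n|t IHt u IHu|t IHt n] /=.
- move=> _; apply: lincomb_ext (lincomb_rat (hV i)) => al xs _.
  have [hi|hi] := ltnP i (size V); first by rewrite (nth_map (fun _ _ => 0)).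
  by rewrite !nth_default ?size_map // rmorph0.
- exact: lincomb_const.
- by move=> _; rewrite -(ratr_nat R); apply: lincomb_const; exact: approximable_ratr.
- by case=> /IHt ht /IHu hu; apply: lincomb_add.
- by move=> /IHt ht; apply: lincomb_opp.
- move=> /IHt ht; apply: lincomb_ext (lincomb_mul (lincomb_rat (crat_const N n%:R)) ht) => al xs _.
  by rewrite ratr_nat mulr_natl.
- by case=> /IHt ht /IHu hu; apply: lincomb_mul.
- by move=> /IHt ht; apply: lincomb_exp.
Qed.

(** A quantifier-free formula is a boolean combination of signs of terms, and in a rational
    environment each term is a [lincomb]. *)
Lemma definable_dec N (V : seq (baire -> seq nat -> rat)) (S : seq R -> Prop) :
  (forall i, crat N (nth (fun _ _ => 0) V i)) -> definable approximable S ->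
  exists P, cpred N P /\ forall al xs, S [seq ratr (v al xs) | v <- V] <-> P al xs.
Proof.
move=> hV [f [hf H]].
exists (fun al xs => QE.qf_eval [seq ratr (v al xs) | v <- V] f); split; last by move=> al xs;
  rewrite H.
have hsub t u : term_over approximable t -> term_over approximable u ->
    lincomb N (fun al xs => QE.eval [seq ratr (v al xs) | v <- V] t - QE.eval [seq ratr (v al xs)
      | v <- V] u).
  by move=> ht hu; apply: lincomb_add; [exact: lincomb_term|apply: lincomb_opp;
    exact: lincomb_term].
elim: f hf {H} => [b|t u|t u|t u|f IHf g IHg|f IHf g IHg|f IHf g IHg|f IHf] /=.
- by move=> _; exact: cpred_const.
- by case=> ht hu; apply: cpred_ext (eq0_dec (hsub _ _ ht hu)) => al xs _; rewrite subr_eq0.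
- by case=> ht hu; apply: cpred_ext (pos_dec (hsub _ _ hu ht)) => al xs _; rewrite subr_gt0.
- case=> ht hu; apply: cpred_ext (cpred_not (pos_dec (hsub _ _ ht hu))) => al xs _.
  by rewrite subr_gt0 -leNgt.
- by case=> /IHf hf /IHg hg; apply: cpred_and.
- by case=> /IHf hf /IHg hg; apply: cpred_or.
- case=> /IHf hf /IHg hg; apply: cpred_ext (cpred_or (cpred_not hf) hg) => al xs _.
  by rewrite implybE.
- by move=> /IHf hf; apply: cpred_not.
Qed.

Local Open Scope nat_scope.

(** * Codes of integers and rationals *)

(** [CodeSeq.code (a :: s)] is [2^a (2 c + 1)] with [c] the code of [s]: the head is a 2-adic
    valuation. Names are written with the generic [pickle], whose decoding is rebuilt here from
    recursive operations. *)
Definition code_head v := logn 2 v.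
Definition code_tail v := v %/ 2 ^ (logn 2 v).+1.

Lemma code_head_code a s : code_head (CodeSeq.code (a :: s)) = a.
Proof.
rewrite /code_head /= lognM ?expn_gt0 // lognX logn_prime //= muln1.
by rewrite lognE /= dvdn2 /= odd_double addn0.
Qed.

Lemma code_tail_code a s : code_tail (CodeSeq.code (a :: s)) = CodeSeq.code s.
Proof.
rewrite /code_tail -/(code_head _) code_head_code /= expnSr divnMA mulKn ?expn_gt0 //.
by rewrite divn2 /= uphalf_double.
Qed.

Lemma decodeE v :
  CodeSeq.decode v = if v == 0 then [::] else code_head v :: CodeSeq.decode (code_tail v).
Proof.
rewrite -{2 3 4}[v]CodeSeq.decodeK; case: (CodeSeq.decode v) => [|a s] //.
rewrite code_head_code code_tail_code CodeSeq.codeK.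
by rewrite (_ : _ == 0 = false) //= muln_eq0 expn_eq0.
Qed.

Lemma cfun_code_head N F : cfun N F -> cfun N (fun al xs => code_head (F al xs)).
Proof.
apply: (cfun_comp1 (G := fun _ => code_head)).
have h : cpred 2 (fun _ xs => 2 ^ (nth 0 xs 0).+1 %| nth 0 xs 1).
  apply: cpred_dvd; last exact: cfun_proj.
  by apply: cfun_exp; [exact: cfun_const|apply: cfun_succ; exact: cfun_proj].
have h' : cpred 2 (fun _ xs => 0 < nth 0 xs 1).
  exact: (cpred_leq (cfun_const 2 1) (cfun_proj 2 1)).
apply: cfun_ext (cfun_sum (cpred_and h' h) (cfun_proj 1 0)) => al [|v []] //= _.
rewrite /code_head; case: v => [|v]; first by rewrite big_ord0 logn0.
under eq_bigr => i _ do rewrite pfactor_dvdn //.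
rewrite sum_ltn; apply/minn_idPr.
by apply: leq_trans (dvdn_leq _ (pfactor_dvdnn 2 v.+1)); rewrite // ltnW // ltn_expl.
Qed.

Lemma cfun_code_tail N F : cfun N F -> cfun N (fun al xs => code_tail (F al xs)).
Proof.
move=> hF; apply: cfun_div => //; apply: cfun_exp; first exact: cfun_const.
by apply: cfun_succ; apply: cfun_code_head.
Qed.

Lemma cfun_nth_map (T : Type) N (s : seq T) (G : T -> baire -> seq nat -> nat) k :
  (forall x, cfun N (G x)) -> cfun N (nth (fun _ _ => 0) (map G s) k).
Proof.
move=> h; elim: s k => [|x s IH] [|k] //=; exact: cfun_const.
Qed.

Lemma cfun_code N (Fs : seq (baire -> seq nat -> nat)) :
  (forall i, cfun N (nth (fun _ _ => 0) Fs i)) ->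
  cfun N (fun al xs => CodeSeq.code [seq F al xs | F <- Fs]).
Proof.
elim: Fs => [|F Fs IH] h; first exact: cfun_const.
apply: cfun_ext (cfun_mul (cfun_exp (cfun_const _ 2) (h 0))
  (cfun_succ (cfun_mul (cfun_const _ 2) (IH (fun i => h i.+1))))) => al xs _.
by rewrite /= mul2n.
Qed.

(** Pairs and dependent pairs are pickled as lists of two codes. *)
Definition csize2 v := [&& v != 0, code_tail v != 0 & code_tail (code_tail v) == 0].

Lemma csize2P v : csize2 v -> CodeSeq.decode v = [:: code_head v; code_head (code_tail v)].
Proof. by case/and3P=> h1 h2 h3; rewrite decodeE (negbTE h1) decodeE (negbTE h2) decodeE h3. Qed.

Lemma decode2 v a b : CodeSeq.decode v = [:: a; b] ->
  [/\ csize2 v, code_head v = a & code_head (code_tail v) = b].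
Proof.
move=> h; rewrite -[v]CodeSeq.decodeK h /csize2 !code_tail_code !code_head_code; split=> //.
by rewrite -lt0n -[_ != 0]lt0n /= !muln_gt0 !expn_gt0.
Qed.

Lemma cpred_csize2 N F : cfun N F -> cpred N (fun al xs => csize2 (F al xs)).
Proof.
move=> hF; have e0 G : cfun N G -> cpred N (fun al xs => G al xs == 0).
  by move=> hG; apply: cpred_eq => //; exact: cfun_const.
apply: cpred_and; first exact/cpred_not/e0.
by apply: cpred_and; [apply/cpred_not/e0/cfun_code_tail|apply/e0/cfun_code_tail/cfun_code_tail].
Qed.

Lemma unpickle_taggedE (I T : countType) v :
  (unpickle v : option {_ : I & T}) =
  if csize2 v then
    obind (fun i : I => omap (@Tagged I i (fun _ => T)) (unpickle (code_head (code_tail v))))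
      (unpickle (code_head v))
  else None.
Proof.
rewrite /unpickle /= /unpickle_tagged; case: ifP => [/csize2P -> //|].
by case E : (CodeSeq.decode v) => [|a [|b []]] //; have [-> ] := decode2 E.
Qed.

Lemma unpickle_pairE (T1 T2 : countType) v :
  (unpickle v : option (T1 * T2)) =
  if csize2 v then
    obind (fun x : T1 => omap (pair x) (unpickle (code_head (code_tail v)))) (unpickle (code_head
      v))
  else None.
Proof.
have -> : (unpickle v : option (T1 * T2)) =
    omap pair_of_tag (unpickle v : option {_ : T1 & T2}) by [].
rewrite unpickle_taggedE; case: ifP => // _.
by case: (unpickle (code_head v)) => //= x; case: (unpickle _).
Qed.

Lemma unpickle_optE v : (unpickle v : option (option nat)) =
  Some (if v == 0 then None else Some (code_head v)).
Proof.
have -> : (unpickle v : option (option nat)) =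
    Some (ohead (pmap (fun x => Some x) (CodeSeq.decode v))) by [].
by rewrite decodeE; case: ifP.
Qed.

(** Integers are pickled through [nat + nat], itself a retract of pairs of options. A code of an
    option is nonzero iff it is a [Some], and the second component takes precedence. *)
Lemma unpickle_intE v : (unpickle v : option int) =
  if csize2 v then
    if code_head (code_tail v) != 0 then Some (Negz (code_head (code_head (code_tail v))))
    else if code_head v != 0 then Some (Posz (code_head (code_head v))) else None
  else None.
Proof.
have -> : (unpickle v : option int) = omap int_of_natsum
    (obind (@sum_of_opair nat nat) (unpickle v : option (option nat * option nat))) by [].
rewrite unpickle_pairE; case: ifP => // _.
rewrite !unpickle_optE /=.
by case: ifP; case: ifP.
Qed.

Lemma unpickle_ratE v : (unpickle v : option rat) =
  obind insub (unpickle v : option (int * int)).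
Proof. by []. Qed.

Definition int_ok v := csize2 v && ((code_head v != 0) || (code_head (code_tail v) != 0)).
Definition int_neg v := code_head (code_tail v) != 0.
Definition int_abs v :=
  if code_head (code_tail v) != 0 then (code_head (code_head (code_tail v))).+1 else code_head
    (code_head v).

Lemma unpickle_int v : (unpickle v : option int) =
  if int_ok v then Some (if int_neg v then (- Posz (int_abs v))%R else Posz (int_abs v)) else None.
Proof.
rewrite unpickle_intE /int_ok /int_neg /int_abs.
by case: (csize2 v) (code_head (code_tail v) != 0) (code_head v != 0) => [] [] [].
Qed.

Lemma int_abs0 v : int_neg v -> int_abs v != 0.
Proof. by rewrite /int_neg /int_abs => ->. Qed.

(** [rat] consists of the pairs of coprime integers with positive denominator, and [unpickle]
    rejects any other pair; hence the coprimality test. *)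
Definition rat_ok v := [&& csize2 v, int_ok (code_head v), int_ok (code_head (code_tail v)),
  ~~ int_neg (code_head (code_tail v)), int_abs (code_head (code_tail v)) != 0 &
  coprime (int_abs (code_head v)) (int_abs (code_head (code_tail v)))].

Definition rat_val v : rat :=
  ((if int_neg (code_head v) then - (int_abs (code_head v))%:R else (int_abs (code_head v))%:R)
   / (int_abs (code_head (code_tail v)))%:R)%R.

Lemma unpickle_rat v : (unpickle v : option rat) =
  if rat_ok v then Some (rat_val v) else None.
Proof.
rewrite unpickle_ratE unpickle_pairE !unpickle_int /rat_ok.
case: (csize2 v) => //=; case: (int_ok (code_head v)) => //=.
case: (int_ok (code_head (code_tail v))) => //=; rewrite /rat_val.
have := @int_abs0 (code_head (code_tail v)).
move: (int_abs (code_head v)) (int_abs (code_head (code_tail v))) (int_neg _) (int_neg _) => a d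
  sa sd hd.
set z := (if sa then _ else _) : int.
have za : `|z|%N = a by rewrite /z; case: (sa); rewrite ?abszN.
case: sd hd => [/(_ isT) hd|_] /=.
  by rewrite insubF //= oppr_gt0 ltz_nat ltn0.
case: (posnP d) => [->|d0]; first by rewrite insubF.
case: (boolP (coprime a d)) => hc /=; last first.
  by rewrite insubF //= za (negbTE hc) andbF.
have hP : (0 < (z, Posz d).2)%R && coprime `|(z, Posz d).1| `|(z,
  Posz d).2| by rewrite /= ltz_nat d0 za.
case: insubP => [u _ hu|]; last by rewrite hP.
congr Some; rewrite -[u]divq_num_den /numq /denq.
have -> : valq u = (z, Posz d) by exact: hu.
by rewrite /z /=; case: (sa); rewrite ?mulrNz.
Qed.

Lemma cpred_int_ok N F : cfun N F -> cpred N (fun al xs => int_ok (F al xs)).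
Proof.
move=> hF; have hn0 G : cfun N G -> cpred N (fun al xs => G al xs != 0).
  by move=> hG; apply/cpred_not/cpred_eq => //; exact: cfun_const.
apply: cpred_and; first exact: cpred_csize2.
by apply: cpred_or; apply: hn0; do ?[apply: cfun_code_head]; do ?[apply: cfun_code_tail].
Qed.

Lemma cpred_int_neg N F : cfun N F -> cpred N (fun al xs => int_neg (F al xs)).
Proof.
move=> hF; apply/cpred_not/cpred_eq; last exact: cfun_const.
by apply/cfun_code_head/cfun_code_tail.
Qed.

Lemma cfun_int_abs N F : cfun N F -> cfun N (fun al xs => int_abs (F al xs)).
Proof.
move=> hF; apply: cfun_if; first exact: cpred_int_neg.
  by apply/cfun_succ/cfun_code_head/cfun_code_head/cfun_code_tail.
by apply/cfun_code_head/cfun_code_head.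
Qed.

Lemma cpred_rat_ok N F : cfun N F -> cpred N (fun al xs => rat_ok (F al xs)).
Proof.
move=> hF; have h1 := cfun_code_head hF; have h2 := cfun_code_head (cfun_code_tail hF).
have h0 := cfun_const N 0.
apply: cpred_and; first exact: cpred_csize2.
apply: cpred_and; first exact: cpred_int_ok.
apply: cpred_and; first exact: cpred_int_ok.
apply: cpred_and; first by apply: cpred_not; exact: cpred_int_neg.
apply: cpred_and; first by apply/cpred_not/cpred_eq => //; exact: cfun_int_abs.
by apply: cpred_coprime; exact: cfun_int_abs.
Qed.

Lemma crat_rat_val N F : cfun N F -> crat N (fun al xs => rat_val (F al xs)).
Proof.
move=> hF; have h1 := cfun_code_head hF; have h2 := cfun_code_head (cfun_code_tail hF).
have hneg := cpred_int_neg h1; have h0 := cfun_const N 0.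
have hd0 := cpred_eq (cfun_int_abs h2) h0.
(* A zero denominator gives [rat_val] the value 0, matched here by zero numerators over the
   denominator 1. *)
exists (fun al xs => if int_abs (code_head (code_tail (F al xs))) == 0 then 0 else
   if int_neg (code_head (F al xs)) then 0 else int_abs (code_head (F al xs))).
exists (fun al xs => if int_abs (code_head (code_tail (F al xs))) == 0 then 0 else
   if int_neg (code_head (F al xs)) then int_abs (code_head (F al xs)) else 0).
exists (fun al xs => (int_abs (code_head (code_tail (F al xs)))).-1).
have ha := cfun_int_abs h1; have hd := cfun_int_abs h2.
split; [exact: cfun_if hd0 h0 (cfun_if hneg h0 ha)|
  exact: cfun_if hd0 h0 (cfun_if hneg ha h0)|exact: cfun_pred hd|].
move=> al xs _; rewrite /rat_val; case: eqP => [->|/eqP d0].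
  by rewrite invr0 !mulr0 subrr mul0r.
rewrite prednK ?lt0n //; congr (_ / _)%R.
by case: ifP => _; rewrite ?sub0r ?subr0.
Qed.

(** * Codes of vectors *)

Section Vectors.
Variable n : nat.

Notation idx := ('I_1 * 'I_n)%type.
Notation entry := {_ : idx & rat}.

Definition idx_ok v := [&& csize2 v, code_head v < 1 & code_head (code_tail v) < n].

Lemma unpickle_idx v : isSome (unpickle v : option idx) = idx_ok v.
Proof.
rewrite unpickle_pairE /idx_ok; case: (csize2 v) => //=.
have ord k w : (unpickle w : option 'I_k) = insub w by [].
rewrite !ord; case: (insubP 'I_1 (code_head v)) => /= [u -> _|/negbTE -> //].
by case: (insubP 'I_n (code_head (code_tail v))) => /= [w -> _|/negbTE -> //].
Qed.

Definition entry_ok v := [&& csize2 v, idx_ok (code_head v) & rat_ok (code_head (code_tail v))].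

Lemma unpickle_entry v : isSome (unpickle v : option entry) = entry_ok v.
Proof.
rewrite unpickle_taggedE /entry_ok; case: (csize2 v) => //=.
rewrite -unpickle_idx; case: (unpickle (code_head v)) => //= i.
by rewrite unpickle_rat; case: (rat_ok _).
Qed.

Lemma cpred_entry_ok N F : cfun N F -> cpred N (fun al xs => entry_ok (F al xs)).
Proof.
move=> hF; have h1 := cfun_code_head hF; have h2 := cfun_code_head (cfun_code_tail hF).
apply: cpred_and; first exact: cpred_csize2.
apply: cpred_and; last exact: cpred_rat_ok.
apply: cpred_and; first exact: cpred_csize2.
apply: cpred_and; apply: cpred_leq; do ?[apply: cfun_succ]; do ?[exact: cfun_const].
  exact: cfun_code_head.
by apply/cfun_code_head/cfun_code_tail.
Qed.

(* [unpickle] on sequences silently drops the entries that fail to decode, so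
   reading the k-th entry has to step over them. *)
Definition skip1 v := if (v != 0) && ~~ entry_ok (code_head v) then code_tail v else v.
Definition cskip v := iter v skip1 v.

Lemma iter_skip1 k v : size (CodeSeq.decode v) <= k ->
  let v' := iter k skip1 v in
  pmap (@unpickle entry) (CodeSeq.decode v') = pmap (@unpickle entry) (CodeSeq.decode v)
  /\ (v' = 0 \/ entry_ok (code_head v')).
Proof.
elim: k v => [|k IH] v.
  rewrite leqn0 size_eq0 => /eqP h; split; first by [].
  by left; move: h; rewrite decodeE; case: eqP.
rewrite iterSr; have [v0|v0] := eqVneq v 0.
  by move=> _; rewrite /skip1 v0 /=; have := IH 0 isT.
have [hok|hok] := boolP (entry_ok (code_head v)).
  move=> _; have e : skip1 v = v by rewrite /skip1 hok andbF.
  have -> : iter k skip1 (skip1 v) = v by rewrite e; elim: k {IH} => //= k ->.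
  by split=> //; right.
have e : skip1 v = code_tail v by rewrite /skip1 v0 hok.
rewrite e [CodeSeq.decode v]decodeE (negbTE v0) /= ltnS => /IH/=.
by move: hok; rewrite -unpickle_entry; case: (unpickle (code_head v)).
Qed.

(** Justifies the [v] iterations in [cskip]: there are never more entries to step over. *)
Lemma size_decode v : size (CodeSeq.decode v) <= v.
Proof.
rewrite -{2}[v]CodeSeq.decodeK; elim: (CodeSeq.decode v) => //= a s IH.
apply: (@leq_trans (CodeSeq.code s).*2.+1); last by rewrite leq_pmull // expn_gt0.
by rewrite ltnS (leq_trans IH) // -addnn leq_addr.
Qed.

Lemma cskipP v x s : pmap (@unpickle entry) (CodeSeq.decode v) = x :: s ->
  (unpickle (code_head (cskip v)) : option entry) = Some x /\
  pmap (@unpickle entry) (CodeSeq.decode (code_tail (cskip v))) = s.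
Proof.
have [h1 h2] := iter_skip1 (size_decode v); rewrite -h1 -/(cskip v) in h2 *.
rewrite decodeE; case: eqP => // hv; case: h2 => // h2 /=.
by move: h2; rewrite -unpickle_entry; case: (unpickle _) => //= y _ [-> ->].
Qed.

Definition centry k v := code_head (cskip (iter k (fun u => code_tail (cskip u)) v)).

Lemma centryP k v s x0 : pmap (@unpickle entry) (CodeSeq.decode v) = s -> k < size s ->
  (unpickle (centry k v) : option entry) = Some (nth x0 s k).
Proof.
elim: k v s => [|k IH] v [|x s] // /cskipP[h1 h2]; first by rewrite /centry.
by move=> hk; rewrite /centry iterSr; apply: IH.
Qed.

Lemma cfun_cskip N F : cfun N F -> cfun N (fun al xs => cskip (F al xs)).
Proof.
apply: (cfun_comp1 (G := fun _ => cskip)).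
have h : cfun 3 (fun _ xs => skip1 (nth 0 xs 1)).
  have h1 := cfun_proj 3 1; apply: cfun_if; do ?[exact: cfun_code_tail|done].
  apply: cpred_and; apply: cpred_not; last by apply/cpred_entry_ok/cfun_code_head.
  by apply: cpred_eq => //; exact: cfun_const.
apply: cfun_ext (cfun_rec (cfun_proj 1 0) h (cfun_proj 1 0)) => al xs _.
by rewrite /cskip; move: {2 3}(nth 0 xs 0) => k; elim: k => //= k ->.
Qed.

Lemma cfun_centry N k F : cfun N F -> cfun N (fun al xs => centry k (F al xs)).
Proof.
move=> hF; apply/cfun_code_head/cfun_cskip.
by elim: k => [|k IH] //=; apply/cfun_code_tail/cfun_cskip.
Qed.

(** A row vector is a finite function on ['I_1 * 'I_n], pickled as the list of its argument-value
    pairs; decoding checks the length and the arguments. *)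
Lemma unpickle_rowE v : (unpickle v : option 'rV[rat]_n) =
  omap (fun f : {ffun idx -> rat} => Matrix f)
    (obind (@finfun.tfgraph_inv idx (fun _ => rat))
      (insub (pmap (@unpickle entry) (CodeSeq.decode v)) : option (#|{: idx}|.-tuple entry))).
Proof.
suff aux (o : option {ffun idx -> rat}) :
  (obind insub o : option 'rV[rat]_n) = omap (fun f => Matrix f) o by exact: aux.
by case: o => //= f; rewrite insubT //=; congr Some; exact: val_inj.
Qed.

Definition coord_code (i : 'I_n) v := code_head (code_tail (centry (enum_rank ((ord0,
  i) : idx)) v)).

Lemma coord_codeP (i : 'I_n) v (M : 'rV[rat]_n) : unpickle v = Some M ->
  rat_val (coord_code i v) = M ord0 i.
Proof.
rewrite unpickle_rowE; case: insubP => //= G _ hG.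
rewrite /finfun.tfgraph_inv; case: eqfunP => //= Dtg [<-].
pose x : idx := (ord0, i); have x0 : entry := Tagged (fun _ => rat) (i := x) 0%R.
have hk : enum_rank x < size (val G) by rewrite size_tuple.
have := centryP x0 (esym hG) hk; rewrite -/(tnth _ _) -(tnth_nth x0 G (enum_rank x)).
rewrite unpickle_taggedE unpickle_rat; case: (csize2 _) => //.
case: (unpickle _) => //= j; case: (rat_ok _) => //= -[e].
have -> : rat_val (coord_code i v) = tagged (tnth G (enum_rank x)) by rewrite -e.
(* Inverting the graph transports each value along an equality of indices; over a constant family
   this is the identity. *)
have ecast_const (a b : idx) (p : a = b) (y : rat) : ecast z rat p y = y by case: _ / p.
by rewrite /fun_of_matrix /= ffunE -/x; apply: esym; apply: ecast_const.
Qed.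

(** Assembled from codes of rationals that are already valid, so that no fraction ever has to be
    reduced and encoded. *)
Definition row_code (w : 'I_n -> nat) :=
  CodeSeq.code [seq CodeSeq.code [:: pickle x; w x.2] | x : idx].

Lemma unpickle_row_code w : (forall i, rat_ok (w i)) ->
  unpickle (row_code w) = Some (\row_i rat_val (w i))%R.
Proof.
move=> hw; rewrite unpickle_rowE /row_code CodeSeq.codeK.
pose f := [ffun x : idx => rat_val (w x.2)].
have -> : pmap (@unpickle entry) [seq CodeSeq.code [:: pickle x; w x.2] | x : idx] = tfgraph f.
  rewrite -codom_tffun /codom /image_mem; elim: (enum _) => //= x s ->.
  rewrite unpickle_taggedE.
  have [-> -> ->] := decode2 (CodeSeq.codeK [:: pickle x; w x.2]).
  by rewrite pickleK unpickle_rat hw /= /total_fun ffunE.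
rewrite valK /= finfun.tfgraphK /=; congr Some; apply/matrixP => i j.
by rewrite /fun_of_matrix /= !ffunE /= [RHS]mxE.
Qed.

Definition ball_code (w : 'I_n -> nat) r := CodeSeq.code [:: row_code w; r].

Lemma unpickle_ball_code w r : (forall i, rat_ok (w i)) -> rat_ok r ->
  unpickle (ball_code w r) = Some ((\row_i rat_val (w i))%R, rat_val r).
Proof.
move=> hw hr; rewrite unpickle_pairE.
have [-> -> ->] := decode2 (CodeSeq.codeK [:: row_code w; r]).
by rewrite unpickle_row_code //= unpickle_rat hr.
Qed.

Lemma cfun_ball_code N (W : 'I_n -> baire -> seq nat -> nat) r :
  (forall i, cfun N (W i)) -> cfun N r ->
  cfun N (fun al xs => ball_code (fun i => W i al xs) (r al xs)).
Proof.
move=> hW hr.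
have hrow : cfun N (fun al xs => row_code (fun i => W i al xs)).
  pose Fs := [seq (fun al xs => CodeSeq.code [:: pickle x; W x.2 al xs]) | x : idx].
  apply: cfun_ext (cfun_code (Fs := Fs) _) => [al xs _|k].
    by rewrite /row_code -map_comp.
  apply: cfun_nth_map => x.
  apply: (cfun_code (Fs := [:: fun _ _ => _; W _])) => -[|[|j]] //=.
    exact: cfun_const.
  by rewrite nth_nil; exact: cfun_const.
apply: (cfun_code (Fs := [:: _; r])) => -[|[|j]] //=.
by rewrite nth_nil; exact: cfun_const.
Qed.

Lemma rat_ok_pickle (q : rat) : rat_ok (pickle q) /\ rat_val (pickle q) = q.
Proof. by have := pickleK q; rewrite unpickle_rat; case: ifP => // _ [->]. Qed.

Definition center_code (i : 'I_n) v := coord_code i (code_head v).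
Definition radius_code v := code_head (code_tail v).

Lemma ball_decode v (c : 'rV[rat]_n * rat) : unpickle v = Some c ->
  (forall i, rat_val (center_code i v) = c.1 ord0 i) /\ rat_val (radius_code v) = c.2.
Proof.
rewrite unpickle_pairE; case: ifP => // _; case E : (unpickle (code_head v)) => [M|] //=.
rewrite unpickle_rat; case: ifP => //= _ [<-] /=; split=> // i.
exact: coord_codeP.
Qed.

Lemma crat_coord i N F : cfun N F -> crat N (fun al xs => rat_val (coord_code i (F al xs))).
Proof. by move=> hF; apply/crat_rat_val/cfun_code_head/cfun_code_tail/cfun_centry. Qed.

Lemma crat_center i N F : cfun N F -> crat N (fun al xs => rat_val (center_code i (F al xs))).
Proof. by move=> hF; apply/crat_coord/cfun_code_head. Qed.

Lemma crat_radius N F : cfun N F -> crat N (fun al xs => rat_val (radius_code (F al xs))).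
Proof. by move=> hF; apply/crat_rat_val/cfun_code_head/cfun_code_tail. Qed.

End Vectors.

(** * Computable reals are approximable *)

Local Open Scope ring_scope.

(** A computable constant comes with a code for the zero oracle, but it is used inside codes whose
    oracle is a name of an open set; answering all queries by zero removes the conflict. *)
Fixpoint deoracle (e : code) : code := match e with
  | COracle => CZero
  | CComp f gs => CComp (deoracle f) (List.map deoracle gs)
  | CPrimRec f g => CPrimRec (deoracle f) (deoracle g)
  | CMu f => CMu (deoracle f)
  | _ => e
  end.

(** A mutual recursion on derivations: [ev_mu] nests derivations under an existential, out of reach
    of the generated induction principle. *)
Lemma eval_deoracle al e xs y (h : eval (fun _ => 0%N) e xs y) :
    eval al (deoracle e) xs y
  with evals_deoracle al es xs ys (h : evals (fun _ => 0%N) es xs ys) :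
    evals al (List.map deoracle es) xs ys.
Proof.
- case: h => /=.
  + exact: ev_zero.
  + exact: ev_succ.
  + exact: ev_proj.
  + by move=> zs; exact: ev_zero.
  + move=> f gs zs us z hgs hf.
    exact: ev_comp (evals_deoracle al _ _ _ hgs) (eval_deoracle al _ _ _ hf).
  + move=> f g zs z hf; exact: ev_prec0 (eval_deoracle al _ _ _ hf).
  + move=> f g n zs r z hr hg.
    exact: ev_precS (eval_deoracle al _ _ _ hr) (eval_deoracle al _ _ _ hg).
  + move=> f zs z hf hlt; apply: ev_mu (eval_deoracle al _ _ _ hf) _ => w hw.
    case: (hlt w hw) => v hv; exists v; exact: eval_deoracle al _ _ _ hv.
- case: h => [zs|g gs zs z us hg hgs] /=; first exact: evs_nil.
  exact: evs_cons (eval_deoracle al _ _ _ hg) (evals_deoracle al _ _ _ hgs).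
Qed.

Lemma cfun_baire p N F : computable_baire p -> cfun N F -> cfun N (fun al xs => p (F al xs)).
Proof.
move=> [e he]; apply: (cfun_comp1 (G := fun _ x => p x)).
by exists (deoracle e) => al [|x []] //= _; apply: eval_deoracle; exact: he.
Qed.

Lemma approximable_Rc a : Rc a -> approximable a.
Proof.
move=> [p [hp [q [hq [_ hqa]]]]].
exists (fun k => rat_val (coord_code (n := 1) ord0 (p k))), 1%N; split.
  by apply: crat_coord; apply: cfun_baire => //; exact: cfun_proj.
move=> k; rewrite (coord_codeP _ (hq k)) mul1r.
apply: le_trans (hqa k); rewrite /edist big_ord1 sqrtr_sqr /ratv !mxE.
exact: lexx.
Qed.

(** * Definability of the graph *)

Local Notation cdef := (definable approximable).

Lemma definable_peval N (P : {mpoly R[N]}) (pos : 'I_N -> nat) : poly_over Rc P ->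
  pdef approximable (fun e => peval P (\row_i e`_(pos i))).
Proof.
move=> hP; have [t [ht H]] : pdef approximable (fun e : seq R =>
    \sum_(m <- msupp P) P@_m * \prod_i e`_(pos i) ^+ m i).
  apply: pdef_sum => m; apply: pdef_mul; first exact/pdef_const/approximable_Rc.
  by apply: pdef_prod => i; apply: pdef_exp; exact: pdef_var.
exists t; split=> // e; rewrite -H /peval mevalE; apply: eq_bigr => m _.
by congr (_ * _); apply: eq_bigr => i _; rewrite mxE.
Qed.

Lemma definable_semialgebraic N (S : 'rV[R]_N -> Prop) (pos : 'I_N -> nat) :
  semialgebraic Rc S -> cdef (fun e => S (\row_i e`_(pos i))).
Proof.
move=> [B [hB hS]]; apply: definable_ext (fun e => iff_sym (hS _)) _.
apply: definable_ex_in => l hl; apply: definable_all_in => d hd.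
have [h1 h2] := hB l hl d hd.
have z0 : pdef approximable (fun _ => 0) by apply: pdef_const; rewrite -(rmorph0 (@ratr R));
  exact: approximable_ratr.
apply: definable_and; apply: definable_all_in => P hP.
  by apply: definable_le => //; apply: definable_peval; exact: h1.
by apply: definable_lt => //; apply: definable_peval; exact: h2.
Qed.

Definition vec k n (e : seq R) : 'rV[R]_n := \row_i e`_(k + i).

Lemma vec_updv k n e v : vec k n (updv e k n v) = \row_i v i.
Proof. by apply/rowP => i; rewrite !mxE nth_updv leq_addr ltn_add2l ltn_ord /= addKn. Qed.

Lemma vec_updv_below k n e B p v : (k + n <= B)%N -> vec k n (updv e B p v) = vec k n e.
Proof.
move=> h; apply/rowP => i; rewrite !mxE nth_updv.
by case: ifP => // /andP[hB _]; have := ltn_ord i; lia.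
Qed.

Lemma nth_updv_below l (e : seq R) B p v : (l < B)%N -> (updv e B p v)`_l = e`_l.
Proof. by rewrite nth_updv => h; rewrite leqNgt h. Qed.

Lemma row_fun n (y : 'rV[R]_n) : exists v : nat -> R, \row_i v i = y.
Proof.
exists (fun j => if insub j is Some i then y 0 i else 0).
by apply/rowP => i; rewrite mxE; rewrite valK.
Qed.

Lemma definable_graph n m (X : 'rV[R]_n -> Prop) (f : 'rV[R]_n -> 'rV[R]_m) a b :
  semialgebraic_fun Rc X f -> cdef (fun e => graph X f (row_mx (vec a n e) (vec b m e))).
Proof.
move=> hf; pose pos (i : 'I_(n + m)) :=
  match split i with inl j => (a + j)%N | inr j => (b + j)%N end.
apply: definable_ext (definable_semialgebraic pos hf) => e.
have -> // : \row_i e`_(pos i) = row_mx (vec a n e) (vec b m e).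
by apply/rowP => i; rewrite !mxE /pos; case: split => j; rewrite mxE.
Qed.

Lemma graphP n m (X : 'rV[R]_n -> Prop) (f : 'rV[R]_n -> 'rV[R]_m) x y :
  graph X f (row_mx x y) <-> X x /\ y = f x.
Proof.
split=> [[x' hx' /eq_row_mx[-> ->]]|[hx ->]]; first by [].
by exists x.
Qed.

(** * Euclidean balls *)

(** Squaring makes membership in a ball polynomial; [0 < r] must be kept because a rational radius
    may be negative. *)
Lemma edist_lt n (x y : 'rV[R]_n) r :
  (edist x y < r) = (0 < r) && (\sum_(i < n) (x 0 i - y 0 i) ^+ 2 < r ^+ 2).
Proof.
rewrite /edist; have [r0|r0] /= := ltP 0 r.
  by rewrite -{1}(gtr0_norm r0) -sqrtr_sqr ltr_sqrt // exprn_gt0.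
by apply/negbTE; rewrite -leNgt (le_trans r0) // sqrtr_ge0.
Qed.

Lemma edistC n (x y : 'rV[R]_n) : edist x y = edist y x.
Proof. by rewrite /edist; congr Num.sqrt; apply: eq_bigr => i _; rewrite -sqrrN opprB. Qed.

Lemma edist_sum_ge0 n (x y : 'rV[R]_n) : 0 <= \sum_(i < n) (x 0 i - y 0 i) ^+ 2.
Proof. by apply: sumr_ge0 => i _; exact: sqr_ge0. Qed.

(* A weighted form of Minkowski's inequality: enough to compare balls, and
   obtained from AM-GM termwise without the Cauchy-Schwarz inequality. *)
Lemma edist_split n (x y z : 'rV[R]_n) t : 0 < t ->
  \sum_(i < n) (x 0 i - z 0 i) ^+ 2 <= (1 + t) * (\sum_(i < n) (x 0 i - y 0 i) ^+ 2) +
     (1 + t^-1) * (\sum_(i < n) (y 0 i - z 0 i) ^+ 2).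
Proof.
move=> t0; rewrite !big_distrr -big_split; apply: ler_sum => i _ /=.
move: (x 0 i) (y 0 i) (z 0 i) => a b c.
rewrite -subr_ge0 (_ : _ - _ = t^-1 * (t * (a - b) - (b - c)) ^+ 2).
  by rewrite mulr_ge0 ?sqr_ge0 // invr_ge0 ltW.
by field; rewrite gt_eqF.
Qed.

Lemma eopen_ball n (c : 'rV[R]_n) r : eopen (fun x => edist c x < r).
Proof.
move=> x; rewrite edist_lt => /andP[r0].
set A := \sum_(i < n) _ => hA; have A0 : 0 <= A by exact: edist_sum_ge0.
(* The slack [d] is split in halves: [t] is chosen with [t A <= d / 2], and the squared radius [s]
   with [(1 + 1/t) s = d / 2]. Using [A + 1] allows [A = 0]. *)
pose d := r ^+ 2 - A; have d0 : 0 < d by rewrite subr_gt0.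
pose t := d / (2 * (A + 1)).
have A1 : 0 < A + 1 by lra.
have t0 : 0 < t by rewrite divr_gt0 // mulr_gt0.
have t1 : 0 < 1 + t^-1 by rewrite addr_gt0 // invr_gt0.
pose s := d / (2 * (1 + t^-1)); have s0 : 0 < s by rewrite divr_gt0 // mulr_gt0.
exists (Num.sqrt s); first by rewrite sqrtr_gt0.
move=> y; rewrite !edist_lt r0 sqrtr_gt0 s0 /= sqr_sqrtr ?ltW // => hy.
apply: (le_lt_trans (edist_split c x y t0)); rewrite -/A.
apply: (@lt_le_trans _ _ ((1 + t) * A + (1 + t^-1) * s)).
  by rewrite ltrD2l ltr_pM2l.
have -> : (1 + t^-1) * s = d / 2.
  by rewrite /s; move: (1 + t^-1) t1 => u u0; field; rewrite gt_eqF.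
have : t * A <= d / 2.
  have -> : t * A = d / 2 * (A / (A + 1)) by rewrite /t; field; rewrite gt_eqF.
  by rewrite ler_piMr ?divr_ge0 ?ltW // ltr_pdivrMr // mul1r ltrDl.
by rewrite /d; lra.
Qed.

Lemma eopen_rat_ball n (U : 'rV[R]_n -> Prop) y : eopen U -> U y ->
  exists c : 'rV[rat]_n * rat, rball c y /\ forall z, rball c z -> U z.
Proof.
move=> hU /hU[eps eps0 heps].
have eps2 : 0 < eps / 2 by rewrite divr_gt0.
have [rho] := rat_in_itvoo eps2.
rewrite in_itv /= => /andP[rho0 hrho].
(* Then [n dl^2 < (n + 1)^2 dl^2 = rho^2], also for [n = 0]. *)
pose dl : R := ratr rho / n.+1%:R.
have dl0 : 0 < dl by rewrite divr_gt0 // ltr0n.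
have hq i : exists q : rat, `|ratr q - y 0 i| < dl.
  have hlt : y 0 i - dl < y 0 i + dl by lra.
  have [q] := rat_in_itvoo hlt.
  by rewrite in_itv /= => hq; exists q; rewrite ltr_distl.
have [q {}hq] := fin_all_exists hq.
exists (\row_i q i, rho).
have h1 : edist (ratv (\row_i q i)) y < ratr rho.
  rewrite edist_lt rho0 /=; apply: (@le_lt_trans _ _ (\sum_(i < n) dl ^+ 2)).
    apply: ler_sum => i _; rewrite /ratv !mxE -[leLHS]real_normK ?num_real //.
    by apply: lerXn2r; rewrite ?nnegrE //; [exact: ltW | exact: ltW (hq i)].
  have e : ratr rho = dl * n.+1%:R :> R by rewrite /dl divfK // pnatr_eq0.
  rewrite sumr_const card_ord -[_ *+ n]mulr_natr e [ltRHS]exprMn ltr_pM2l ?exprn_gt0 //.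
  by rewrite -natrX ltr_nat; nia.
split=> // z hz; apply: heps; move: h1 hz; rewrite /rball /= edistC !edist_lt.
set r : R := ratr rho in rho0 hrho *; rewrite eps0 rho0 /= => h1 h2.
(* With weight [t = 1] the squared distance is below [2 rho^2 + 2 rho^2 < eps^2], as
   [rho < eps / 2]. *)
apply: (le_lt_trans (edist_split y (ratv (\row_i q i)) z ltr01)).
rewrite invr1; nra.
Qed.

(** The block at [B] is scratch space for the quantified point; [T] must not read it, or writing the
    point would change the set. *)
Lemma definable_in_ball k n l B (T : seq R -> 'rV[R]_n -> Prop) :
  (k + n <= B)%N -> (l < B)%N ->
  (forall e v y, T (updv e B n v) y <-> T e y) ->
  cdef (fun e => T e (vec B n e)) ->
  cdef (fun e => exists x, edist (vec k n e) x < e`_l /\ T e x).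
Proof.
move=> hk hl hT hdef.
have hsum : pdef approximable (fun e => \sum_(i < n) (e`_(k + i) - e`_(B + i)) ^+ 2).
  apply: pdef_sum => i; apply: pdef_exp; apply: pdef_add; first exact: pdef_var.
  by apply: pdef_opp; exact: pdef_var.
have z0 : pdef approximable (fun _ => 0) by apply: pdef_const; rewrite -(rmorph0 (@ratr R));
  exact: approximable_ratr.
have hball : cdef (fun e => edist (vec k n e) (vec B n e) < e`_l).
  apply: definable_ext (definable_and (definable_lt z0 (pdef_var approximable l))
    (definable_lt hsum (pdef_exp 2 (pdef_var approximable l)))) => e.
  rewrite edist_lt; under [in X in _ <-> is_true X]eq_bigr => i _ do rewrite !mxE.
  by split=> /andP.
apply: definable_ext (definable_exv approximable_ratr B n (definable_and hball hdef)) => e.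
split=> [[v]|[x [hx hTx]]].
  rewrite vec_updv vec_updv_below // nth_updv_below // => -[h1 /hT h2].
  by exists (\row_i v i).
have [v hv] := row_fun x; exists v.
by rewrite vec_updv vec_updv_below // nth_updv_below // hv hT.
Qed.

(** Inclusion in [T] means not meeting the complement of [T]. *)
Lemma definable_ball_sub k n l B (T : seq R -> 'rV[R]_n -> Prop) :
  (k + n <= B)%N -> (l < B)%N ->
  (forall e v y, T (updv e B n v) y <-> T e y) ->
  cdef (fun e => T e (vec B n e)) ->
  cdef (fun e => forall x, edist (vec k n e) x < e`_l -> T e x).
Proof.
move=> hk hl hT hdef.
have stab e x : ~ ~ T e x -> T e x.
  have [v <-] := row_fun x; have := @definable_stable _ _ _ (updv e B n v) hdef.
  by rewrite vec_updv !hT.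
apply: definable_ext (definable_not
  (@definable_in_ball k n l B (fun e x => ~ T e x) hk hl _ (definable_not hdef))) => [e|e v y].
  split=> [h x hx|h [x [hx]]]; last by apply; exact: h.
  by apply: stab => hn; apply: h; exists x; split.
by rewrite hT.
Qed.

(** * The enumerating realizers *)

Section Enumeration.
Variable m : nat.

(** Candidate balls are read off plain lists of [m + 1] rational codes, center then radius. All
    rational balls occur, and no pickled vector has to be decoded. *)
Definition cand_coord (i : 'I_m) v := code_head (iter i code_tail v).
Definition cand_radius v := code_head (iter m code_tail v).
Definition cand_ok v := [forall i, rat_ok (cand_coord i v)] && rat_ok (cand_radius v).
Definition cand v : 'rV[rat]_m * rat :=
  (\row_i rat_val (cand_coord i v), rat_val (cand_radius v)).

Lemma code_head_iter_code s j : (j < size s)%N ->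
  code_head (iter j code_tail (CodeSeq.code s)) = nth 0%N s j.
Proof.
elim: s j => // a s IH [|j] hj; first by rewrite /= -/(CodeSeq.code (a :: s)) code_head_code.
by rewrite iterSr code_tail_code IH.
Qed.

Lemma cand_surj (c : 'rV[rat]_m * rat) : exists v, cand_ok v /\ cand v = c.
Proof.
pose s := rcons [seq pickle (c.1 0 i) | i <- enum 'I_m] (pickle c.2).
have hs : size s = m.+1 by rewrite size_rcons size_map size_enum_ord.
have hcoord i : cand_coord i (CodeSeq.code s) = pickle (c.1 0 i).
  rewrite /cand_coord code_head_iter_code ?hs ?ltnS 1?ltnW // nth_rcons size_map size_enum_ord.
  by rewrite ltn_ord (nth_map i) ?size_enum_ord // nth_ord_enum.
have hrad : cand_radius (CodeSeq.code s) = pickle c.2.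
  by rewrite /cand_radius code_head_iter_code ?hs // nth_rcons size_map size_enum_ord ltnn eqxx.
exists (CodeSeq.code s); split.
  apply/andP; split; last by rewrite hrad (rat_ok_pickle _).1.
  by apply/forallP => i; rewrite hcoord (rat_ok_pickle _).1.
rewrite /cand hrad (rat_ok_pickle _).2 [RHS]surjective_pairing.
by congr (_, _); apply/rowP => i; rewrite mxE hcoord (rat_ok_pickle _).2.
Qed.

Lemma cfun_iter_code_tail N j F : cfun N F -> cfun N (fun al xs => iter j code_tail (F al xs)).
Proof. by move=> hF; elim: j => //= j IH; apply: cfun_code_tail. Qed.

Lemma cpred_forall N (T : finType) (P : T -> baire -> seq nat -> bool) :
  (forall i, cpred N (P i)) -> cpred N (fun al xs => [forall i, P i al xs]).
Proof.
move=> h; have : cpred N (fun al xs => all (fun i => P i al xs) (enum T)).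
  by elim: (enum T) => [|i s IH]; [exact: cpred_const | exact: cpred_and].
apply: cpred_ext => al xs _; apply/allP/forallP => H i; last by [].
by apply: H; rewrite mem_enum.
Qed.

Lemma cpred_cand_ok N F : cfun N F -> cpred N (fun al xs => cand_ok (F al xs)).
Proof.
move=> hF; apply: cpred_and; last exact/cpred_rat_ok/cfun_code_head/cfun_iter_code_tail.
by apply: cpred_forall => i; exact/cpred_rat_ok/cfun_code_head/cfun_iter_code_tail.
Qed.

Lemma rball_radius0 y : ~ rball (0 : 'rV[rat]_m, 0 : rat) y.
Proof. by rewrite /rball edist_lt /= rmorph0 ltxx. Qed.

(** A name lists a ball at every index, so a rejected candidate is replaced by the empty ball of
    radius 0. [J] extracts the candidate, leaving the rest of the index to [P]; the output is fixed
    before [U] is mentioned. *)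
Lemma enumerate_balls (P : baire -> seq nat -> bool) (J : nat -> nat) :
  cpred 1 P -> cfun 1 (fun _ xs => J (nth 0%N xs 0)) ->
  exists e, forall al, exists q, computes e al q /\ forall U : 'rV[R]_m -> Prop,
    (forall y, U y <-> exists k, [/\ P al [:: k], cand_ok (J k) & rball (cand (J k)) y]) ->
    open_name q U.
Proof.
move=> hP hJ.
pose out v := ball_code (fun i => cand_coord i v) (cand_radius v).
pose dflt := pickle (0 : 'rV[rat]_m, 0 : rat).
pose G al xs := if P al xs && cand_ok (J (nth 0%N xs 0)) then out (J (nth 0%N xs 0)) else dflt.
have [e he] : cfun 1 G.
  apply: cfun_if; [by apply: cpred_and => //; apply: cpred_cand_ok| |exact: cfun_const].
  by apply: cfun_ball_code => [i|]; exact/cfun_code_head/cfun_iter_code_tail.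
exists e => al; exists (fun k => G al [:: k]); split=> [k|U hU]; first exact: he.
exists (fun k => if P al [:: k] && cand_ok (J k) then cand (J k) else (0, 0)).
split=> [k|y].
  rewrite /G /=; case: (P _ _) => /=; last by rewrite pickleK.
  case: (boolP (cand_ok (J k))) => [/andP[/forallP h1 h2]|_]; last by rewrite pickleK.
  exact: unpickle_ball_code.
rewrite hU; split=> [[k [h1 h2 h3]]|[k]].
  by exists k; rewrite h1 h2.
by case: ifP => [/andP[h1 h2] h3|_ /rball_radius0//]; exists k.
Qed.

End Enumeration.

(** * The domain and the images of open sets *)

Section Main.
Variables (n m : nat) (X : 'rV[R]_n -> Prop) (f : 'rV[R]_n -> 'rV[R]_m).
Hypothesis f_sa : semialgebraic_fun Rc X f.

(** [X] is the projection of the graph, so the value of [f] needs a block of its own, behind the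
    center at 0, the radius at [n] and the point at [n.+1]. *)
Lemma definable_ball_in_domain :
  cdef (fun e => forall x, edist (vec 0 n e) x < e`_n -> X x).
Proof.
apply: (@definable_ball_sub 0 n n n.+1 (fun _ x => X x)) => //.
have h := definable_exv approximable_ratr (n.+1 + n) m (definable_graph n.+1 (n.+1 + n) f_sa).
apply: definable_ext h => e; split=> [[v /graphP[h _]]|h].
  by rewrite vec_updv_below in h.
have [v hv] := row_fun (f (vec n.+1 n e)); exists v.
by apply/graphP; rewrite vec_updv vec_updv_below // hv.
Qed.

(** The source ball fills the variables up to [n], the target ball those from [n.+1] to [n.+1 + m];
    [y] and then [x] follow as scratch blocks, in the order of the quantifiers. *)
Lemma definable_ball_in_image :
  cdef (fun e => forall y, edist (vec n.+1 m e) y < e`_(n.+1 + m) ->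
    exists x, edist (vec 0 n e) x < e`_n /\ graph X f (row_mx x y)).
Proof.
pose B := (n.+1 + m).+1.
apply: (@definable_ball_sub n.+1 m (n.+1 + m) B
  (fun e y => exists x, edist (vec 0 n e) x < e`_n /\ graph X f (row_mx x y))) => //.
  by move=> e v y; rewrite vec_updv_below ?nth_updv_below // /B; lia.
apply: (@definable_in_ball 0 n n (B + m) (fun e x => graph X f (row_mx x (vec B m e)))) => //.
- by rewrite /B; lia.
- by rewrite /B; lia.
- by move=> e v x; rewrite vec_updv_below.
exact: definable_graph.
Qed.

Lemma eval_vec k p (V : seq (baire -> seq nat -> rat)) al xs (c : 'rV[rat]_p) :
  (forall i : 'I_p, nth (fun _ _ => 0) V (k + i) al xs = c 0 i) ->
  vec k p [seq ratr (v al xs) | v <- V] = ratv c.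
Proof.
move=> h; apply/rowP => i; rewrite !mxE -h.
have [hi|hi] := ltnP (k + i) (size V); first by rewrite (nth_map (fun _ _ => 0)).
by rewrite !nth_default ?size_map // rmorph0.
Qed.

Lemma re_open_domain : eopen X -> re_open X.
Proof.
move=> hX.
pose V : seq (baire -> seq nat -> rat) :=
  rcons [seq (fun _ xs => rat_val (cand_coord i (nth 0%N xs 0))) | i <- enum 'I_n]
    (fun _ xs => rat_val (cand_radius n (nth 0%N xs 0))).
have sV : size [seq (fun (_ : baire) xs => rat_val (cand_coord i (nth 0%N xs 0))) | i <- enum
  'I_n] = n.
  by rewrite size_map size_enum_ord.
have hV i : crat 1 (nth (fun _ _ => 0) V i).
  rewrite nth_rcons sV; case: ltnP => hi; last case: eqP => _; last exact: crat_const.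
    rewrite (nth_map (Ordinal hi)) ?size_enum_ord //.
    by apply/crat_rat_val/cfun_code_head/cfun_iter_code_tail/cfun_proj.
  by apply/crat_rat_val/cfun_code_head/cfun_iter_code_tail/cfun_proj.
have [P [hP HP]] := definable_dec hV definable_ball_in_domain.
have [e he] := @enumerate_balls n P id hP (cfun_proj 1 0).
have [q [hq hU]] := he (fun _ => 0%N); exists q; split; first by exists e.
apply: hU => y.
have PE k : P (fun _ => 0%N) [:: k] <-> (forall x, rball (cand n k) x -> X x).
  rewrite -HP (@eval_vec 0 n V _ _ (cand n k).1) => [|i].
    rewrite (nth_map (fun _ _ => 0)) ?size_rcons ?sV // nth_rcons sV ltnn eqxx /=.
    by [].
  rewrite add0n nth_rcons sV ltn_ord (nth_map i) ?size_enum_ord // nth_ord_enum.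
  by rewrite mxE.
split=> [hy|[k [/PE h1 h2 h3]]]; last exact: h1.
have [c [hc1 hc2]] := eopen_rat_ball hX hy; have [k [hk ek]] := cand_surj c.
by exists k; rewrite ek; split=> //; apply/PE; rewrite ek.
Qed.

(** An index codes a pair: its head selects a ball from the given name, its tail a candidate target
    ball, so that all combinations get tested. *)
Lemma effectively_open_image : open_map X f -> effectively_open X f.
Proof.
move=> hopen.
pose src al (xs : seq nat) : nat := al (code_head (nth 0%N xs 0)).
pose J k := code_tail k.
pose V1 : seq (baire -> seq nat -> rat) :=
  rcons [seq (fun al xs => rat_val (center_code i (src al xs))) | i <- enum 'I_n]
    (fun al xs => rat_val (radius_code (src al xs))).
pose V2 : seq (baire -> seq nat -> rat) :=
  rcons [seq (fun _ xs => rat_val (cand_coord i (J (nth 0%N xs 0)))) | i <- enum 'I_m]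
    (fun _ xs => rat_val (cand_radius m (J (nth 0%N xs 0)))).
have s1 : size V1 = n.+1 by rewrite size_rcons size_map size_enum_ord.
have s2 : size V2 = m.+1 by rewrite size_rcons size_map size_enum_ord.
pose V := (V1 ++ V2)%SEQ.
have n1 (i : 'I_n) : nth (fun _ _ => 0) V (0 + i) =
  (fun al xs => rat_val (center_code i (src al xs))).
  rewrite nth_cat s1 add0n ltnS ltnW // nth_rcons size_map size_enum_ord ltn_ord.
  by rewrite (nth_map i) ?size_enum_ord // nth_ord_enum.
have n2 : nth (fun _ _ => 0) V n = (fun al xs => rat_val (radius_code (src al xs))).
  by rewrite nth_cat s1 leqnn nth_rcons size_map size_enum_ord ltnn eqxx.
have n3 (i : 'I_m) : nth (fun _ _ => 0) V (n.+1 + i) =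
    (fun _ xs => rat_val (cand_coord i (J (nth 0%N xs 0)))).
  rewrite nth_cat s1 ltnNge leq_addr /= addKn nth_rcons size_map size_enum_ord ltn_ord.
  by rewrite (nth_map i) ?size_enum_ord // nth_ord_enum.
have n4 : nth (fun _ _ => 0) V (n.+1 + m) =
    (fun _ xs => rat_val (cand_radius m (J (nth 0%N xs 0)))).
  by rewrite nth_cat s1 ltnNge leq_addr /= addKn nth_rcons size_map size_enum_ord ltnn eqxx.
have hsrc : cfun 1 src by apply/cfun_oracle/cfun_code_head/cfun_proj.
have hJ : cfun 1 (fun _ xs => J (nth 0%N xs 0)) by apply/cfun_code_tail/cfun_proj.
have hV i : crat 1 (nth (fun _ _ => 0) V i).
  have [hi|hi] := ltnP i n.
    by rewrite (n1 (Ordinal hi)); exact: crat_center.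
  have [->|hi'] := eqVneq i n; first by rewrite n2; exact: crat_radius.
  have {hi hi'} [j ->] : exists j, i = (n.+1 + j)%N by exists (i - n.+1)%N; lia.
  have [hj|hj] := ltnP j m.
    by rewrite (n3 (Ordinal hj)); apply/crat_rat_val/cfun_code_head/cfun_iter_code_tail.
  have [->|hj'] := eqVneq j m; first by rewrite n4;
    apply/crat_rat_val/cfun_code_head/cfun_iter_code_tail.
  by rewrite nth_default ?size_cat ?s1 ?s2; [exact: crat_const | lia].
have [P [hP HP]] := definable_dec hV definable_ball_in_image.
have [e he] := @enumerate_balls m P J hP hJ.
exists e => U [hU hUX] al [c [hc hUc]].
have [q [hq hopenq]] := he al; exists q; split; last by [].
apply: hopenq => y.
have PE k : P al [:: k] <-> (forall y', rball (cand m (J k)) y' ->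
    exists x, rball (c (code_head k)) x /\ (X x /\ y' = f x)).
  have [hcen hrad] := ball_decode (hc (code_head k)).
  rewrite -HP (@eval_vec n.+1 m V _ _ (cand m (J k)).1) => [|i]; last by rewrite n3 mxE.
  rewrite (@eval_vec 0 n V _ _ (c (code_head k)).1) => [|i]; last by rewrite n1.
  rewrite !(nth_map (fun _ _ => 0)) ?size_cat ?s1 ?s2; [|lia|lia].
  rewrite n2 n4 /src /= hrad.
  by split=> h y' /h[x [h1 h2]]; exists x; split=> //; apply/graphP.
split=> [[x Ux ->]|[k [/PE h1 h2 /h1[x [hx [_ ->]]]]]]; last first.
  by exists x => //; apply/hUc; exists (code_head k).
have /hUc[i hi] := Ux.
have hsub z : rball (c i) z -> U z by move=> hz; apply/hUc; exists i.
have hball : eopen (rball (c i)) by exact: eopen_ball.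
(* [f] is open on the single source ball containing [x], so some rational ball around [f x] lies in
   the image of that ball. *)
have himg := hopen _ hball (fun z hz => hUX z (hsub z hz)).
have [b [hb1 hb2]] := eopen_rat_ball himg (ex_intro2 _ _ x hi erefl).
have [v [hv ev]] := cand_surj b.
(* The index pairing the source ball [i] with the target candidate [v]. *)
pose k := CodeSeq.code (i :: CodeSeq.decode v); exists k.
have hk1 : code_head k = i by exact: code_head_code.
have hk2 : J k = v by rewrite /J code_tail_code CodeSeq.decodeK.
rewrite hk2 ev; split=> //; apply/PE => y'; rewrite hk2 ev hk1 => /hb2[z hz ->].
by exists z; split=> //; split=> //; exact/hUX/hsub.
Qed.

End Main.

Theorem theorem5 (n m : nat) (X : 'rV[R]_n -> Prop) (f : 'rV[R]_n -> 'rV[R]_m) :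
  computable_fun X f ->
  open_map X f ->
  semialgebraic_fun Rc X f ->
  eopen X ->
  re_open X /\ effectively_open X f.
Proof.
move=> _ hopen hsa hX; split; first exact: re_open_domain hsa hX.
exact: effectively_open_image hsa hopen.
Qed.
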